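(* Let $\ell$ and $p$ be prime numbers. If $\ell\equiv 3\bmod 4$ and $p\equiv 1\bmod 4$, then $\mathcal{H}_\ell$ is not maximal over any finite field of characteristic $p$.
   Context: For $d\in\mathbb{Z}_{>0}$ the $d$-th Chebyshev polynomial $\Phi_d(x)\in\mathbb{Z}[x]$ is the unique polynomial such that $\Phi_d(x+\frac1x)=x^d+\frac1{x^d}$ in $\mathbb{Z}[x,x^{-1}]$. For a prime $p$, $\varphi_d(x)\in\mathbb{F}_p[x]$ denotes the reduction of $\Phi_d(x)$ modulo $p$. For $p\nmid 2d$, $\varphi_d(x)$ is separable, and $\mathcal{H}_d$ denotes the complete, regular, absolutely irreducible (hyperelliptic) curve over $\mathbb{F}_p$ (and, by base change, over extensions of $\mathbb{F}_p$) given by the affine equation $y^2=\varphi_d(x)$; its genus is $g(\mathcal{H}_d)=\lfloor (d-1)/2\rfloor$. For $q$ a power of $p$, the curve $\mathcal{H}_d$ is called maximal over $\mathbb{F}_{q^2}$ if $\#\mathcal{H}_d(\mathbb{F}_{q^2})=q^2+1+2g(\mathcal{H}_d)q$. ''Not maximal over any finite field of characteristic $p$'' means that there is no power $q$ of $p$ such that the curve is maximal over $\mathbb{F}_{q^2}$. *)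

(* Defs.v *)
From HB Require Import structures.
From mathcomp Require Import all_boot all_order all_algebra.
From mathcomp Require Import fraction ring.

Set Implicit Arguments.
Unset Strict Implicit.
Unset Printing Implicit Defensive.

Import GRing.Theory.
Local Open Scope ring_scope.

Local Notation "x %:F" := (@tofrac _ x).

(* The ring Z[x, 1/x] is viewed inside its fraction field Z(x). *)
Definition ratX : {fraction {poly int}} := 'X%:F.

Definition is_chebyshev (d : nat) (P : {poly int}) : bool :=
  (map_poly intr P).[ratX + ratX^-1] == ratX ^+ d + ratX ^- d.

Fact ratX_neq0 : ratX != 0.
Proof. by rewrite /ratX tofrac_eq0 polyX_eq0. Qed.

Fact chebyshev_identity (d : nat) : exists P : {poly int},
  forall (K : fieldType) (x : K), x != 0 ->
  (map_poly intr P).[x + x^-1] = x ^+ d + x ^- d.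
Proof.
suff [P [Q [hP _]]] : exists P Q : {poly int},
    (forall (K : fieldType) (x : K), x != 0 ->
       (map_poly intr P).[x + x^-1] = x ^+ d + x ^- d)
    /\ (forall (K : fieldType) (x : K), x != 0 ->
       (map_poly intr Q).[x + x^-1] = x ^+ d.+1 + x ^- d.+1) by exists P.
elim: d => [|d [P [Q [hP hQ]]]].
  exists 2%:R, 'X; split=> K x x0; last by rewrite map_polyX hornerX !expr1.
  by rewrite rmorph_nat !expr0 invr1 hornerMn hornerC.
exists Q, ('X * Q - P); split=> // K x x0.
rewrite rmorphB rmorphM /= map_polyX hornerD hornerN hornerM hornerX hP // hQ //.
by rewrite !exprS; field; rewrite x0 expf_neq0.
Qed.

Fact is_chebyshev_exists (d : nat) : exists P, is_chebyshev d P.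
Proof.
have [P hP] := chebyshev_identity d; exists P.
by apply/eqP/hP/ratX_neq0.
Qed.

Fact horner_add_inv_eq0 (K : fieldType) (j : {rmorphism {poly int} -> K})
    (D : {poly int}) :
  injective j -> (map_poly intr D).[j 'X + (j 'X)^-1] = 0 -> D = 0.
Proof.
move=> jI hD; apply/eqP; case: (eqVneq D 0) => // D0.
have sD : size D = (size D).-1.+1 by rewrite prednK // lt0n size_poly_eq0.
set n := (size D).-1 in sD.
have x0 : j 'X != 0 by rewrite -(rmorph0 j) (inj_eq jI) polyX_eq0.
pose S : {poly int} :=
  \sum_(i < n.+1) (D`_i)%:~R * ('X ^+ (n - i) * ('X ^+ 2 + 1) ^+ i).
have S0 : S = 0.
  apply: jI; rewrite rmorph0 -(mulr0 (j 'X ^+ n)) -hD.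
  rewrite rmorph_sum (@horner_coef_wide _ n.+1); last first.
    by rewrite -sD; apply: size_poly.
  rewrite mulr_sumr; apply: eq_bigr => i _.
  rewrite coef_map /= !rmorphM /= rmorph_int !rmorphXn rmorphD rmorph1 /=.
  rewrite rmorphXn /=.
  have -> : j 'X ^+ 2 + 1 = j 'X * (j 'X + (j 'X)^-1) by field.
  rewrite exprMn [X in _ * X]mulrA -exprD subnK; last by rewrite -ltnS.
  by rewrite mulrCA.
have : S.[0] = D`_n.
  rewrite /S horner_sum big_ord_recr /= big1 => [|i _].
    have -> : (D`_n)%:~R = (D`_n)%:P by rewrite -[in RHS](intz D`_n) rmorph_int.
    rewrite subnn expr0 mul1r add0r.
    rewrite hornerM hornerC horner_exp hornerD hornerXn hornerC.
    by rewrite add0r expr1n mulr1.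
  rewrite !hornerM [X in _ * (X * _)]hornerXn expr0n subn_eq0 leqNgt ltn_ord.
  by rewrite mul0r mulr0.
rewrite S0 horner0 => /esym /eqP.
by rewrite -[D`_n]/(lead_coef D) lead_coef_eq0 (negPf D0).
Qed.

Fact is_chebyshev_unique (d : nat) (P Q : {poly int}) :
  is_chebyshev d P -> is_chebyshev d Q -> P = Q.
Proof.
move=> /eqP hP /eqP hQ; apply/eqP; rewrite -subr_eq0; apply/eqP.
apply: (@horner_add_inv_eq0 _ (@tofrac {poly int})).
  by move=> x y /eqP; rewrite tofrac_eq => /eqP.
by rewrite rmorphB hornerD hornerN [X in X - _]hP [X in _ - X]hQ subrr.
Qed.

Definition chebyshev (d : nat) : {poly int} := xchoose (is_chebyshev_exists d).

Fact chebyshevP (d : nat) (P : {poly int}) :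
  is_chebyshev d P <-> P = chebyshev d.
Proof.
have h := xchooseP (is_chebyshev_exists d).
by split=> [hP | ->]; [exact: is_chebyshev_unique hP h | exact: h].
Qed.

(* The reduction mod p followed by base change from F_p to F, when F has
   characteristic p. *)
Definition phi (F : fieldType) (d : nat) : {poly F} := map_poly intr (chebyshev d).

Definition genus (d : nat) : nat := (d.-1)./2.

(* u ^ n f (1 / u), for f of degree at most n. *)
Definition reciprocal (F : fieldType) (n : nat) (f : {poly F}) : {poly F} :=
  \poly_(i < n.+1) f`_(n - i).

(* For f separable of degree 2g+1 or 2g+2, the complete regular model of
   y^2 = f(x) is the union of the affine curve y^2 = f(x) and of the affine
   curve w^2 = u^(2g+2) f(1/u), glued along x != 0, u != 0 by
   (u, w) = (1/x, y/x^(g+1)).  Both charts are regular, since both right-hand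
   sides are separable.  Thus the rational points are those of the first chart
   (inl) together with the points (0, w) of the second one (inr w). *)
Definition hyperelliptic_points (F : finFieldType) (g : nat) (f : {poly F}) :
    {set (F * F) + F} :=
  [set P | match P with
           | inl (x, y) => y ^+ 2 == f.[x]
           | inr w => w ^+ 2 == (reciprocal g.+1.*2 f).[0]
           end].

Fact hyperelliptic_glue (F : fieldType) (g : nat) (f : {poly F}) (x y : F) :
  (size f <= g.+1.*2.+1)%N -> x != 0 ->
  (y ^+ 2 == f.[x]) =
  ((y / x ^+ g.+1) ^+ 2 == (reciprocal g.+1.*2 f).[x^-1]).
Proof.
move=> sf x0; set n := g.+1.*2.
have xn : x ^+ n != 0 by rewrite expf_neq0.
have -> : (reciprocal n f).[x^-1] = f.[x] / x ^+ n.
  rewrite horner_poly (horner_coef_wide _ sf) mulr_suml.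
  rewrite (reindex_inj rev_ord_inj) /=; apply: eq_bigr => i _.
  have hi : (i <= n)%N by rewrite -ltnS.
  rewrite subSS subKn // -mulrA; congr (_ * _).
  by rewrite -[in RHS](subnK hi) exprD invfM mulrCA divff ?expf_neq0 // mulr1 exprVn.
by rewrite expr_div_n -exprM muln2 (inj_eq (mulIf (invr_neq0 xn))).
Qed.

(* The F-rational points of H_d, for F of characteristic not dividing 2d. *)
Definition Hpoints (F : finFieldType) (d : nat) : {set (F * F) + F} :=
  hyperelliptic_points (genus d) (phi F d).

(* Meaningful when #|F| = q ^ 2. *)
Definition maximal_over (d q : nat) (F : finFieldType) : Prop :=
  #|Hpoints F d| = (q ^ 2 + 1 + 2 * genus d * q)%N.

(* Main.v *)
Require Import Defs.
From mathcomp Require Import all_boot all_order all_algebra all_field.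
From mathcomp Require Import cyclic zify ring.

Set Implicit Arguments.
Unset Strict Implicit.
Unset Printing Implicit Defensive.

Import Order.TTheory GRing.Theory Num.Theory.

(** Write Q = q^2 = #|F| and let chi be the quadratic character of F.  Then
    #H_l(F) = Q + 1 + S with S the sum of chi (phi_l x) over x in F, so H_l is
    maximal over F exactly when S = (l - 1) q.  The proof shows that S never
    has this value, by turning the equality into a statement about prime
    factorizations of Gauss sums that is wrong when p = 1 and l = 3 modulo 4.

    Every x in F is t + 1/t for exactly two t in the disjoint union of F^* and
    of the group of norm 1 elements of the quadratic extension L
    (torus_sum), and phi_l (t + 1/t) = t^l + t^-l.  So 2 S is a sum over these
    two cyclic groups, of orders Q - 1 and Q + 1, of a function of t^l, and
    the same expression with l replaced by 1 vanishes.  If l does not divide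
    the order of a group, then t -> t^l permutes it and its share of 2 S is
    the same for l as for 1.  If l divides the order, then Fourier analysis
    (twisted_decimation) writes the difference of the two shares as the sum of
    2 (l - 1) terms J_c, one for each c modulo 4l prime to 4l.  Here J_c is a
    Jacobi sum on F in the split case and an Eisenstein sum on L in the
    nonsplit case; in both, a relation with Gauss sums gives |J_c| = q.  Hence
    S = (l - 1) q forces J_c = q for each c.

    Let E be F or L accordingly, m = #|E| - 1, D = m / (4l), and let G(a) be
    the Gauss sum on E of the a-th power of a generator of the group of
    characters of E^*.  In terms of G, the equalities J_c = q become
    G(c D)^4 = G((c + 2 l) D)^4 for all odd c prime to l.

    This contradicts Stickelberger's theorem (stickelberger): up to units at
    a prime P of the cyclotomic integers above p, G(a) is G(1)^s(a), where s(a)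
    is the sum of the digits of a in base p.  As p = 1 modulo 4,
    multiplication by p permutes each of the classes c = 1 and c = 3 modulo 4
    of residues modulo 4l prime to l, so that the sum of s(c D) over a class
    is proportional to the sum of the residues c in it.  As l = 3 modulo 4,
    these two sums of residues differ by 4l, hence the products of the G(c D)
    over the two classes have different valuations at P, while c -> c + 2l
    exchanges the classes (gauss_not_symmetric). *)

Local Open Scope ring_scope.

(** * Generators and power sums in a finite field *)

Lemma prim_root_neq0 (R : fieldType) n (z : R) : n.-primitive_root z -> z != 0.
Proof.
move=> pz; have n0 := prim_order_gt0 pz; apply/eqP => z0.
have := prim_expr_order pz; rewrite z0 expr0n gtn_eqF // => /esym/eqP.
by rewrite oner_eq0.
Qed.

Lemma sum_geom_unity (R : fieldType) (z : R) N : z ^+ N = 1 -> z != 1 ->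
  \sum_(j < N) z ^+ j = 0.
Proof.
move=> zN z1; apply: (mulfI (x := 1 - z)); first by rewrite subr_eq0 eq_sym.
have := subrXX 1 z N; rewrite expr1n zN subrr mulr0 => /esym h.
rewrite -[RHS]h; congr (_ * _).
by apply: eq_bigr => j _; rewrite expr1n mul1r.
Qed.

Lemma sum_unity_roots (L : finFieldType) (V : nmodType) n (w : L) (f : L -> V) :
  n.-primitive_root w -> \sum_(t | t ^+ n == 1) f t = \sum_(j < n) f (w ^+ j).
Proof.
move=> pw; pose h (j : 'I_n) := w ^+ j.
have hinj : injective h.
  move=> i j /= /eqP; rewrite (eq_prim_root_expr pw) !modn_small // => /eqP.
  exact: val_inj.
transitivity (\sum_(x in h @: predT) f x).
  apply: eq_bigl => t; apply/eqP/imsetP => [/(prim_rootP pw)[j ->] | [j _ ->]].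
    by exists j.
  by rewrite exprAC (prim_expr_order pw) expr1n.
by rewrite big_imset //= => i j _ _ /hinj.
Qed.

Section FiniteField.

Variable E : finFieldType.
Implicit Types (g x y : E).

Lemma expf_card_pred x : x != 0 -> x ^+ #|E|.-1 = 1.
Proof.
move=> x0; apply: (mulfI x0); rewrite -exprS prednK ?expf_card ?mulr1 //.
by rewrite ltnW ?finNzRing_gt1.
Qed.

Lemma finField_generator_exists : exists g : E, #|E|.-1.-primitive_root g.
Proof.
have E1 : (1 < #|E|)%N := finNzRing_gt1 E.
have /hasP [g _ pg] : has (#|E|.-1.-primitive_root) (enum (predC1 (0 : E))).
  apply: has_prim_root; rewrite ?enum_uniq //; first by lia.
  - apply/allP => x; rewrite mem_enum inE => x0; apply/unity_rootP.
    exact: expf_card_pred.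
  - by rewrite -cardE cardC1.
by exists g.
Qed.

Lemma sum_finField_exp (V : nmodType) (F : E -> V) g :
  #|E|.-1.-primitive_root g ->
  \sum_x F x = F 0 + \sum_(j < #|E|.-1) F (g ^+ j).
Proof.
move=> pg; rewrite (bigD1 0) //= -(sum_unity_roots F pg); congr (_ + _).
apply: eq_bigl => x; apply/idP/eqP => [x0 | x1]; first exact: expf_card_pred.
apply: contra_eq_neq x1 => ->; rewrite expr0n gtn_eqF ?(prim_order_gt0 pg) //.
by rewrite eq_sym oner_eq0.
Qed.

Lemma finField_expg g x : #|E|.-1.-primitive_root g -> x != 0 ->
  exists2 j, (j < #|E|.-1)%N & x = g ^+ j.
Proof.
move=> pg /expf_card_pred x1; have [i ->] := prim_rootP pg x1.
by exists i.
Qed.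

Lemma sum_finField_pow p r i : prime p -> #|E| = (p ^ r)%N ->
  (i < #|E|.-1)%N -> \sum_(x : E) x ^+ i = 0.
Proof.
move=> p_pr hE hi; have E1 : (1 < #|E|)%N := finNzRing_gt1 E.
have pE := card_finPcharP hE p_pr.
case: i hi => [_|i hi].
  under eq_bigr do rewrite expr0.
  rewrite sumr_const; case: r hE => [hE|r hE]; first by move: E1; rewrite hE.
  by rewrite hE expnS mulrnA (pcharf0 pE) mul0rn.
have [g pg] := finField_generator_exists.
rewrite (sum_finField_exp _ pg) expr0n add0r.
under eq_bigr do rewrite exprAC.
apply: sum_geom_unity; first by rewrite exprAC (prim_expr_order pg) expr1n.
rewrite -(expr0 g) (eq_prim_root_expr pg) mod0n modn_small //.
Qed.

End FiniteField.

(** * Gauss and Jacobi sums *)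

Section GaussSums.

Variable E : finFieldType.
Implicit Types (x y u : E) (W V e : E -> algC).

(** All characters take the value 0 at 0, the trivial one included: then a
    pointwise product of characters is again one, with no exception at 0. *)
Definition mult_char W := [/\ W 0 = 0, W 1 = 1 & {morph W : x y / x * y}].

Definition add_char e :=
  [/\ e 0 = 1, {morph e : x y / x + y >-> x * y} & exists x, e x != 1].

Definition gauss W e := \sum_x W x * e x.

Definition jacobi W V := \sum_x W x * V (1 - x).

Lemma normC1_of_unity (z : algC) n : (0 < n)%N -> z ^+ n = 1 -> `|z| = 1.
Proof.
move=> n0 zn; apply/eqP; rewrite -(@pexpr_eq1 _ _ n) //.
by rewrite -normrX zn normr1.
Qed.

Lemma conjC_norm1 (z : algC) : `|z| = 1 -> z^* = z^-1.
Proof. by move=> z1; rewrite invC_norm z1 expr1n invr1 mul1r. Qed.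

Lemma mult_charX W x n : mult_char W -> W (x ^+ n) = W x ^+ n.
Proof.
case=> _ W1 WM; elim: n => [|n IH]; first by rewrite !expr0.
by rewrite !exprS WM IH.
Qed.

Lemma mult_char_norm W x : mult_char W -> x != 0 -> `|W x| = 1.
Proof.
move=> hW x0; have E1 : (1 < #|E|)%N := finNzRing_gt1 E.
apply: (@normC1_of_unity _ #|E|.-1); first by lia.
by rewrite -mult_charX // expf_card_pred //; case: hW.
Qed.

Lemma mult_char_neq0 W x : mult_char W -> x != 0 -> W x != 0.
Proof. by move=> hW x0; rewrite -normr_eq0 mult_char_norm // oner_neq0. Qed.

Lemma mult_charV W x : mult_char W -> W x^-1 = (W x)^-1.
Proof.
move=> hW; have [W0 W1 WM] := hW.
have [-> | x0] := eqVneq x 0; first by rewrite invr0 W0 invr0.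
apply: (mulfI (mult_char_neq0 hW x0)).
by rewrite -WM !divff // mult_char_neq0.
Qed.

Lemma mult_char_conj W x : mult_char W -> (W x)^* = W x^-1.
Proof.
move=> hW; have [-> | x0] := eqVneq x 0.
  by case: hW => W0 _ _; rewrite invr0 W0 conjC0.
by rewrite conjC_norm1 ?mult_charV ?mult_char_norm.
Qed.

Lemma mult_char_mul W V : mult_char W -> mult_char V ->
  mult_char (fun x => W x * V x).
Proof.
case=> W0 W1 WM [V0 V1 VM]; split=> [||x y].
- by rewrite W0 mul0r.
- by rewrite W1 V1 mul1r.
- by rewrite WM VM mulrACA.
Qed.

Lemma mult_char_exp W n : mult_char W -> mult_char (fun x => W x ^+ n.+1).
Proof.
case=> W0 W1 WM; split=> [||x y].
- by rewrite W0 expr0n.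
- by rewrite W1 expr1n.
- by rewrite WM exprMn.
Qed.

Lemma mult_charN1_sq W : mult_char W -> W (-1) ^+ 2 = 1.
Proof. by move=> hW; rewrite -mult_charX // sqrrN expr1n; case: hW. Qed.

Lemma sum_mult_char W u : mult_char W -> u != 0 -> W u != 1 ->
  \sum_x W x = 0.
Proof.
move=> [_ _ WM] u0 Wu; apply: (mulfI (x := 1 - W u)).
  by rewrite subr_eq0 eq_sym.
rewrite mulr0 mulrBl mul1r mulr_sumr.
rewrite [X in X - _](reindex_inj (mulfI u0)) /=.
by rewrite -sumrB big1 // => x _; rewrite WM subrr.
Qed.

Lemma sum_add_char e : add_char e -> \sum_x e x = 0.
Proof.
move=> [_ eD [u eu]]; apply: (mulfI (x := 1 - e u)).
  by rewrite subr_eq0 eq_sym.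
rewrite mulr0 mulrBl mul1r mulr_sumr.
rewrite [X in X - _](reindex_inj (addrI u)) /=.
by rewrite -sumrB big1 // => x _; rewrite eD subrr.
Qed.

Lemma sum_add_charM e y : add_char e -> y != 0 -> \sum_x e (x * y) = 0.
Proof.
move=> he y0; rewrite -[RHS](sum_add_char he).
by rewrite [RHS](reindex_inj (mulIf y0)).
Qed.

Lemma add_charN e x : add_char e -> e (- x) = (e x)^-1.
Proof.
case=> e0 eD _; have : e x * e (- x) = 1 by rewrite -eD subrr.
move=> h; have ex0 : e x != 0.
  by apply: contraTneq (oner_neq0 algC) => ex0; rewrite -h ex0 mul0r eqxx.
by apply: (mulfI ex0); rewrite h divff.
Qed.

Lemma add_charX e x n : add_char e -> e (x *+ n) = e x ^+ n.
Proof.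
case=> e0 eD _; elim: n => [|n IH]; first by rewrite mulr0n expr0.
by rewrite mulrS exprS eD IH.
Qed.

Lemma add_char_conj e x : add_char e -> (e x)^* = e (- x).
Proof.
move=> he; rewrite add_charN //; apply: conjC_norm1.
have [p p_pr pE] := finPcharP E; apply: (@normC1_of_unity _ p).
  exact: prime_gt0.
rewrite -add_charX // -mulr_natr (pcharf0 pE) mulr0; by case: he.
Qed.

Variable e : E -> algC.
Hypothesis he : add_char e.

Lemma gauss_conj W : mult_char W ->
  (gauss W e)^* = W (-1) * gauss (fun x => W x^-1) e.
Proof.
move=> hW; have [W0 W1 WM] := hW.
rewrite /gauss rmorph_sum mulr_sumr /= (reindex_inj oppr_inj) /=.
apply: eq_bigr => x _; rewrite rmorphM /= mult_char_conj // (add_char_conj _ he).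
by rewrite opprK mulrA -WM mulN1r invrN.
Qed.

(** Substituting x = y t separates the variables in the double sum: the sum
    over y of e (y (t - 1)) is orthogonality, which leaves only t = 1. *)
Lemma gauss_norm_sq W u : mult_char W -> u != 0 -> W u != 1 ->
  gauss W e * (gauss W e)^* = #|E|%:R.
Proof.
move=> hW u0 Wu; have [W0 W1 WM] := hW; have [e0 eD _] := he.
have -> : gauss W e * (gauss W e)^* =
    \sum_y \sum_x (W x * e x) * ((W y)^* * e (- y)).
  rewrite /gauss rmorph_sum mulr_sumr; apply: eq_bigr => y _.
  rewrite mulr_suml; apply: eq_bigr => x _.
  by rewrite rmorphM /= (add_char_conj _ he).
have -> : \sum_y \sum_x (W x * e x) * ((W y)^* * e (- y)) =
    \sum_(y | y != 0) \sum_t W t * e (y * (t - 1)).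
  rewrite (bigD1 0) //= big1 => [|x _]; last by rewrite W0 conjC0 mul0r mulr0.
  rewrite add0r; apply: eq_bigr => y y0.
  rewrite (reindex_inj (mulfI y0)) /=; apply: eq_bigr => t _.
  rewrite mult_char_conj // WM mulrBr mulr1 eD mulrACA; congr (_ * _).
  by rewrite mulrAC -WM divff // W1 mul1r.
rewrite exchange_big /=.
transitivity (\sum_t (W t * (if t == 1 then #|E|%:R else 0) - W t)).
  apply: eq_bigr => t _; rewrite -mulr_sumr -[X in _ = _ - X]mulr1 -mulrBr.
  have -> : \sum_(y | y != 0) e (y * (t - 1)) = \sum_y e (y * (t - 1)) - 1.
    by rewrite [in RHS](bigD1 0) //= mul0r e0 addrAC subrr add0r.
  congr (_ * (_ - _)); have [-> | t1] := eqVneq t 1.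
    by under eq_bigr do rewrite subrr mulr0 e0; rewrite sumr_const.
  by rewrite sum_add_charM // subr_eq0.
rewrite sumrB (sum_mult_char hW u0 Wu) subr0 (bigD1 1) //= eqxx W1 mul1r.
by rewrite big1 ?addr0 // => t /negPf ->; rewrite mulr0.
Qed.

Lemma gauss_norm W u : mult_char W -> u != 0 -> W u != 1 ->
  `|gauss W e| ^+ 2 = #|E|%:R.
Proof. by move=> hW u0 Wu; rewrite normCK (gauss_norm_sq hW u0 Wu). Qed.

Lemma gauss_neq0 W u : mult_char W -> u != 0 -> W u != 1 -> gauss W e != 0.
Proof.
move=> hW u0 Wu; rewrite -normr_eq0 -sqrf_eq0 (gauss_norm hW u0 Wu) pnatr_eq0.
by have := finNzRing_gt1 E; case: #|E|.
Qed.

Lemma gaussV W u : mult_char W -> u != 0 -> W u != 1 ->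
  gauss W e * gauss (fun x => W x^-1) e = W (-1) * #|E|%:R.
Proof.
move=> hW u0 Wu; rewrite -(gauss_norm_sq hW u0 Wu) gauss_conj //.
rewrite [RHS]mulrCA; congr (_ * _).
by rewrite mulrA -expr2 mult_charN1_sq // mul1r.
Qed.

(** Both sides count pairs by their sum: the pairs of sum t are, for t != 0,
    the pairs of sum 1 scaled by t, and those of sum 0 contribute a full
    character sum, which vanishes as W V is not trivial. *)
Lemma gauss_jacobi W V u : mult_char W -> mult_char V ->
  u != 0 -> W u * V u != 1 ->
  gauss W e * gauss V e = jacobi W V * gauss (fun x => W x * V x) e.
Proof.
move=> hW hV u0 WVu; have [W0 W1 WM] := hW; have [V0 V1 VM] := hV.
have [e0 eD _] := he.
transitivity (\sum_t \sum_x W x * V (t - x) * e t).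
  transitivity (\sum_x \sum_y W x * V (y - x) * e y); last exact: exchange_big.
  rewrite /gauss mulr_suml; apply: eq_bigr => x _; rewrite mulr_sumr.
  rewrite [RHS](reindex_inj (addrI x)) /=; apply: eq_bigr => y _.
  by rewrite addrC addKr eD mulrACA.
rewrite (bigD1 0) //=.
have -> : \sum_x W x * V (0 - x) * e 0 = 0.
  under eq_bigr do rewrite e0 mulr1 sub0r.
  transitivity (V (-1) * \sum_x W x * V x); last first.
    by rewrite (sum_mult_char (mult_char_mul hW hV) u0 WVu) mulr0.
  by rewrite mulr_sumr; apply: eq_bigr => x _; rewrite mulrCA -VM mulN1r.
rewrite add0r /gauss [in RHS](bigD1 0) //= W0 !mul0r add0r mulr_sumr.
apply: eq_bigr => t t0; rewrite /jacobi mulr_suml.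
rewrite (reindex_inj (mulfI t0)) /=; apply: eq_bigr => x _.
rewrite -[X in V (X - _)]mulr1 -mulrBr WM VM; ring.
Qed.

End GaussSums.

(** * Reduction of cyclotomic integers to a finite field *)

(** The cyclotomic polynomial is monic over the integers and minimal over the
    rationals, so the remainder of f by it has to vanish. *)
Lemma cyclotomic_dvd_zero n (z : algC) (f : {poly int}) :
  n.-primitive_root z -> (map_poly intr f).[z] = 0 ->
  exists h : {poly int}, f = h * 'Phi_n.
Proof.
move=> pz fz; have Pm := Cyclotomic_monic n.
have [q [qE qm] minP] := minCpolyP z.
pose h := Pdiv.CommonRing.rdivp f 'Phi_n.
pose k := Pdiv.CommonRing.rmodp f 'Phi_n.
have fE : f = h * 'Phi_n + k := Pdiv.RingMonic.rdivp_eq Pm f.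
have Phiz : (map_poly intr 'Phi_n).[z] = 0.
  by rewrite (Cintr_Cyclotomic pz); apply/rootP; rewrite root_cyclotomic.
have kz : (map_poly intr k).[z] = 0.
  by move: fz; rewrite {1}fE rmorphD rmorphM /= hornerD hornerM Phiz mulr0 add0r.
suff k0 : k = 0 by exists h; rewrite {1}fE k0 addr0.
pose kQ : {poly rat} := map_poly intr k.
have szk : size kQ = size k by apply: size_map_inj_poly; [exact: intr_inj|].
have : q %| kQ.
  rewrite -minP; apply/rootP; rewrite -[RHS]kz -map_poly_comp; congr _.[z].
  by apply: eq_map_poly => i /=; rewrite rmorph_int.
apply: contraTeq => k0; apply/negP => /dvdp_leq.
rewrite -size_poly_eq0 szk size_poly_eq0 => /(_ k0); apply/negP; rewrite -ltnNge.
have -> : size q = size 'Phi_n.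
  transitivity (size (minCpoly z)).
    by rewrite qE size_map_poly.
  by rewrite (minCpoly_cyclotomic pz) size_cyclotomic size_Cyclotomic.
apply: Pdiv.CommonRing.ltn_rmodpN0; exact: monic_neq0.
Qed.

(** The element g is a root of X^n - 1, the product of the Phi_d with d | n; a
    root of Phi_d with d a proper divisor would have order dividing d. *)
Lemma root_Phi_finField (E : finFieldType) (g : E) n :
  n.-primitive_root g -> (map_poly intr 'Phi_n).[g] = 0.
Proof.
move=> pg; have n0 := prim_order_gt0 pg.
have : (map_poly intr (\prod_(d <- divisors n) 'Phi_d) : {poly E}).[g] = 0.
  rewrite prod_Cyclotomic // rmorphB rmorph1 /= map_polyXn.
  by rewrite !hornerE (prim_expr_order pg) subrr.
rewrite rmorph_prod horner_prod => /eqP; rewrite prodf_seq_eq0 => /hasP[d].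
rewrite -dvdn_divisors //= => dn /eqP hd.
suff <- : d = n by [].
have d0 : (0 < d)%N by exact: dvdn_gt0 dn.
apply/eqP; rewrite eqn_dvd dn (prim_order_dvd pg) -subr_eq0; apply/eqP.
have : (map_poly intr (\prod_(d' <- divisors d) 'Phi_d') : {poly E}).[g] = 0.
  rewrite rmorph_prod horner_prod (bigD1_seq d) ?divisors_uniq //=.
    by rewrite hd mul0r.
  by rewrite divisors_id.
by rewrite prod_Cyclotomic // rmorphB rmorph1 /= map_polyXn !hornerE.
Qed.

Section Reduction.

Variables (E : finFieldType) (n : nat) (z : algC) (g : E).
Hypotheses (pz : n.-primitive_root z) (pg : n.-primitive_root g).

(** The graph of the ring morphism from Z[z] to E that sends z to g. As a
    relation on algC it spares the construction of Z[z] as a type; its kernel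
    is the prime of Z[z] used below, and reduces_to0 says that it is a
    function. *)
Definition reduces_to (X : algC) (y : E) :=
  exists f : {poly int}, X = (map_poly intr f).[z] /\ y = (map_poly intr f).[g].

Lemma reduces_to0 y : reduces_to 0 y -> y = 0.
Proof.
move=> [f [/esym fz ->]]; have [h ->] := cyclotomic_dvd_zero pz fz.
by rewrite rmorphM hornerM root_Phi_finField ?mulr0.
Qed.

Lemma reduces_toD X y X' y' : reduces_to X y -> reduces_to X' y' ->
  reduces_to (X + X') (y + y').
Proof.
by move=> [f [-> ->]] [f' [-> ->]]; exists (f + f'); rewrite !rmorphD !hornerD.
Qed.

Lemma reduces_toN X y : reduces_to X y -> reduces_to (- X) (- y).
Proof. by move=> [f [-> ->]]; exists (- f); rewrite !rmorphN !hornerN. Qed.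

Lemma reduces_toM X y X' y' : reduces_to X y -> reduces_to X' y' ->
  reduces_to (X * X') (y * y').
Proof.
by move=> [f [-> ->]] [f' [-> ->]]; exists (f * f'); rewrite !rmorphM !hornerM.
Qed.

Lemma reduces_to_nat k : reduces_to k%:R k%:R.
Proof. by exists k%:R; rewrite !rmorph_nat !hornerMn !hornerC. Qed.

Lemma reduces_to_gen : reduces_to z g.
Proof. by exists 'X; rewrite !map_polyX !hornerX. Qed.

Lemma reduces_toX X y k : reduces_to X y -> reduces_to (X ^+ k) (y ^+ k).
Proof.
move=> h; elim: k => [|k IH]; first exact: (reduces_to_nat 1).
by rewrite !exprS; apply: reduces_toM.
Qed.

Lemma reduces_to_sum (I : finType) (F : I -> algC) (f : I -> E) :
  (forall i, reduces_to (F i) (f i)) -> reduces_to (\sum_i F i) (\sum_i f i).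
Proof.
move=> h; apply: (big_ind2 reduces_to) => //; first exact: (reduces_to_nat 0).
exact: reduces_toD.
Qed.

Lemma reduces_to_inj X y y' : reduces_to X y -> reduces_to X y' -> y = y'.
Proof.
move=> h h'; apply/eqP; rewrite -subr_eq0; apply/eqP/reduces_to0.
by rewrite -(subrr X); apply: reduces_toD h (reduces_toN h').
Qed.

End Reduction.

(** * Digit rotations modulo p^r - 1 *)

(** For a < p^r - 1, the number (p^j a) mod (p^r - 1) is a with its r digits in
    base p rotated by j places. Each digit of a visits each place once, so this
    sum is the sum of the digits of a times (p^r - 1) / (p - 1). In this form
    the digit sum is additive over families of residues that multiplication by
    p permutes. *)
Definition rotation_sum (p r a : nat) : nat :=
  (\sum_(j < r) (p ^ j * a) %% (p ^ r).-1)%N.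

Section Rotations.

Local Open Scope nat_scope.

Variables p r : nat.
Hypothesis p_gt1 : 1 < p.
Let N := (p ^ r).-1.

Lemma pred_expn_eq : p ^ r = N.+1.
Proof. by rewrite prednK // expn_gt0 (ltnW p_gt1). Qed.

Lemma coprime_pred_expn j : 0 < r -> coprime N (p ^ j).
Proof.
move=> r0; apply: coprimeXr; rewrite coprime_sym.
have : coprime (p ^ r) N by rewrite pred_expn_eq coprimeSn.
by rewrite coprime_pexpl.
Qed.

(** Appending the digit d to a puts d at the place j of the j-th rotation, with
    no carry. No further reduction occurs because the digits of p a + d are not
    all equal to p - 1. *)
Lemma rotation_shift j a d : j < r -> d < p -> 0 < p * a + d < N ->
  (p ^ j * (p * a + d)) %% N = (p ^ j.+1 * a) %% N + p ^ j * d.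
Proof.
move=> jr dp /andP[a0 aN].
pose u := p ^ (r - j.+1); have uE : p ^ j.+1 * u = N.+1.
  by rewrite -expnD subnKC // pred_expn_eq.
have u0 : 0 < u by rewrite expn_gt0 (ltnW p_gt1).
have h1 : p ^ j.+1 * a = a %/ u * N + (a %/ u + p ^ j.+1 * (a %% u)).
  by rewrite {1}(divn_eq a u) mulnDr mulnCA uE mulnS addnCA addnA.
have pj0 : 0 < p ^ j by rewrite expn_gt0 (ltnW p_gt1).
have hh : a %/ u < p ^ j.
  rewrite ltn_divLR // -(ltn_pmul2l (ltnW p_gt1)) mulnA -expnS uE; lia.
have hw : a %% u < u by rewrite ltn_mod.
(* u splits a into the high digits a %/ u, which wrap around, and the others. *)
pose V := a %/ u + p ^ j.+1 * (a %% u) + p ^ j * d.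
have hV : V <= N.
  have hd : p ^ j * d <= p ^ j * p.-1 by rewrite leq_mul2l; lia.
  have hw' : p ^ j.+1 * (a %% u) <= p ^ j.+1 * u.-1 by rewrite leq_mul2l; lia.
  have e1 : p ^ j.+1 * u = p ^ j.+1 * u.-1 + p ^ j.+1 by rewrite -mulnSr prednK.
  have e2 : p ^ j.+1 = p ^ j * p.-1 + p ^ j.
    by rewrite -mulnSr prednK ?expnSr // ltnW.
  by rewrite /V; lia.
have hVe : p ^ j * (p * a + d) = a %/ u * N + V.
  by rewrite mulnDr mulnA -expnSr h1 -addnA.
have hVN : V < N.
  rewrite ltn_neqAle hV andbT; apply: contraTneq aN => VN.
  have r0 : 0 < r by lia.
  have : N %| p ^ j * (p * a + d) by rewrite hVe VN dvdn_add // dvdn_mull.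
  rewrite Gauss_dvdr ?coprime_pred_expn // => /dvdn_leq; rewrite -leqNgt; exact.
rewrite hVe h1 !modnMDl modn_small // modn_small //.
by move: hVN; rewrite /V; lia.
Qed.

Lemma rotation_sum_step a d : 0 < r -> d < p -> 0 < p * a + d < N ->
  rotation_sum p r (p * a + d) = rotation_sum p r a + d * \sum_(j < r) p ^ j.
Proof.
move=> r0 dp h; rewrite /rotation_sum -/N.
rewrite (eq_bigr (fun j : 'I_r => (p ^ j.+1 * a) %% N + p ^ j * d)); last first.
  by move=> j _; rewrite rotation_shift.
rewrite big_split /= -big_distrl /= (mulnC _ d).
apply/eqP; rewrite eqn_add2r; apply/eqP; have prN := pred_expn_eq.
move: prN; rewrite -/N; clearbody N; case: r r0 => // r' _ prN.
rewrite big_ord_recr [RHS]big_ord_recl /= addnC; congr (_ + _)%N.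
by rewrite prN expn0 -addn1 mulnDl mulnC modnMDl.
Qed.

Lemma sum_expn_pred : p.-1 * \sum_(j < r) p ^ j = N.
Proof. by rewrite -predn_exp. Qed.

End Rotations.

(** * Prime factorization of Gauss sums *)

Section Stickelberger.

Variables (E : finFieldType) (p r : nat) (g : E) (z : algC) (e : E -> algC).
Hypotheses (p_pr : prime p) (p_gt2 : (2 < p)%N) (cardE : #|E| = (p ^ r)%N).
Let m := #|E|.-1.
Implicit Types (x y : E) (a b : nat).

Let pE : p \in [pchar E] := card_finPcharP cardE p_pr.

Lemma pred_card_eq : #|E| = m.+1.
Proof. by rewrite prednK // ltnW ?finNzRing_gt1. Qed.

Lemma card_exponent_gt0 : (0 < r)%N.
Proof. by have := finNzRing_gt1 E; rewrite cardE; case: r. Qed.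

Lemma pred_card_gt1 : (1 < m)%N.
Proof.
rewrite /m cardE; case: r card_exponent_gt0 => // k _.
have : (p <= p ^ k.+1)%N by rewrite expnS leq_pmulr // expn_gt0 prime_gt0.
by lia.
Qed.

(** The reduction of the Jacobi sum J(a, 1).  For x != 1, the fraction
    x^(m - a) / (1 - x) is 1 / (1 - x) minus a geometric sum, and every power
    of x with exponent less than m has sum 0 over E. *)
Lemma sum_inv_exp_inv a : (0 < a)%N -> (a.+1 < m)%N ->
  \sum_x x^-1 ^+ a * (1 - x)^-1 ^+ 1 = - a.+1%:R :> E.
Proof.
move=> a0 am.
have invE k x : (0 < k < m)%N -> x^-1 ^+ k = x ^+ (m - k).
  move=> /andP[k0 km]; have [-> | x0] := eqVneq x 0.
    by rewrite invr0 !expr0n !gtn_eqF // subn_gt0.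
  apply: (mulfI (expf_neq0 k x0)).
  by rewrite -exprMn divff // expr1n -exprD subnKC ?expf_card_pred // ltnW.
have m1 := pred_card_gt1.
pose k := (m - a)%N.
transitivity (\sum_(x : E) ((1 - x)^-1 - \sum_(i < k) x ^+ i
                      + (if x == 1 then k%:R else 0))).
  apply: eq_bigr => x _; rewrite expr1; have [-> | x1] := eqVneq x 1.
    rewrite subrr invr0 mulr0 sub0r.
    under eq_bigr do rewrite expr1n.
    by rewrite sumr_const card_ord addNr.
  have x1' : 1 - x != 0 by rewrite subr_eq0 eq_sym.
  rewrite addr0 invE; last by lia.
  apply: (mulIf x1'); rewrite mulfVK // mulrBl mulVf //.
  have := subrXX 1 x k; rewrite expr1n mulrC => h.
  rewrite -/k (_ : \sum_(i < k) x ^+ i = \sum_(i < k) 1 ^+ (k.-1 - i) * x ^+ i).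
    by rewrite -h opprB addrC subrK.
  by apply: eq_bigr => i _; rewrite expr1n mul1r.
rewrite big_split /= -big_mkcond /= big_pred1_eq sumrB exchange_big /=.
rewrite [X in _ - X]big1 => [|i _]; last first.
  apply: (@sum_finField_pow _ p r) => //; rewrite -/m.
  by apply: leq_trans (ltn_ord i) _; rewrite /k; lia.
rewrite subr0 (reindex_inj (@subrI _ 1)) /=.
under eq_bigr => x _ do rewrite opprB addrC subrK -[x^-1]expr1 invE ?m1 //.
rewrite (@sum_finField_pow _ p r) ?add0r //; last by rewrite -/m; lia.
apply/eqP; rewrite -addr_eq0 -natrD.
have -> : (k + a.+1 = #|E|)%N by rewrite pred_card_eq /k; lia.
rewrite cardE -(dvdn_pcharf pE) dvdn_exp //; exact: card_exponent_gt0.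
Qed.

Hypotheses (pg : m.-primitive_root g) (pz : m.-primitive_root z).
Hypotheses (he : add_char e) (eF : forall x, e (x ^+ p) = e x).

Definition dlog x := index x [seq g ^+ j | j <- iota 0 m].

(** The generator of the group of characters of E^* which, read modulo the
    prime that sends z to the inverse of g, is x -> 1/x: the inverse of the
    Teichmueller character. With this sign the Gauss sum of its a-th power has
    the digit sum of a as its valuation. *)
Definition teich_inv x : algC := if x == 0 then 0 else z ^+ dlog x.

Local Notation tau := teich_inv.

Lemma teich_inv0 : tau 0 = 0. Proof. by rewrite /tau eqxx. Qed.

Lemma teich_inv_gen j : tau (g ^+ j) = z ^+ j.
Proof.
rewrite /tau expf_eq0 (negPf (prim_root_neq0 pg)) andbF; apply/eqP.
rewrite (eq_prim_root_expr pz) -(eq_prim_root_expr pg); apply/eqP.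
have hin : g ^+ j \in [seq g ^+ j | j <- iota 0 m].
  apply/mapP; exists (j %% m)%N; last by rewrite prim_expr_mod.
  by rewrite mem_iota /= ltn_mod (prim_order_gt0 pg).
have hlt : (dlog (g ^+ j) < m)%N.
  by move: hin; rewrite -index_mem size_map size_iota.
have := nth_index 0 hin; rewrite -/(dlog _) (nth_map 0%N) ?size_iota //.
by rewrite nth_iota.
Qed.

Lemma teich_inv_mult_char : mult_char tau.
Proof.
split; first exact: teich_inv0.
  by rewrite -(expr0 g) teich_inv_gen.
move=> x y; have [-> | x0] := eqVneq x 0; first by rewrite mul0r teich_inv0 mul0r.
have [-> | y0] := eqVneq y 0; first by rewrite mulr0 teich_inv0 mulr0.
have [i _ ->] := finField_expg pg x0; have [j _ ->] := finField_expg pg y0.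
by rewrite -exprD !teich_inv_gen exprD.
Qed.

Lemma teich_inv_exp_mult_char a : (0 < a)%N -> mult_char (fun x => tau x ^+ a).
Proof. by case: a => // a _; apply: mult_char_exp teich_inv_mult_char. Qed.

Definition gauss_teich a := gauss (fun x => tau x ^+ a) e.

Local Notation G := gauss_teich.
Local Notation "X ~> y" := (reduces_to z g^-1 X y) (at level 70).

Lemma teich_inv_reduces x : tau x ~> x^-1.
Proof.
have [-> | x0] := eqVneq x 0.
  rewrite teich_inv0 invr0; exact: (reduces_to_nat z g^-1 0).
have [j _ ->] := finField_expg pg x0.
by rewrite teich_inv_gen -exprVn; apply: reduces_toX (reduces_to_gen _ _).
Qed.

Lemma gauss_teich_frobenius a : G (p * a) = G a.
Proof.
rewrite /G /gauss [RHS](reindex_inj (fmorph_inj (pFrobenius_aut pE))) /=.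
apply: eq_bigr => x _; rewrite pFrobenius_autE eF exprM.
by rewrite (mult_charX x p teich_inv_mult_char).
Qed.

(** The Jacobi sum J(a, 1) reduces to - (a + 1), hence it is a unit at the
    prime unless adding 1 to a produces a carry. *)
Lemma gauss_teich_succ a : (0 < a)%N -> (a.+1 < m)%N -> exists X,
  X ~> - a.+1%:R /\ G a * G 1 = X * G a.+1.
Proof.
move=> a0 am; exists (jacobi (fun x => tau x ^+ a) (fun x => tau x ^+ 1)).
split.
  rewrite -sum_inv_exp_inv //; apply: reduces_to_sum => x.
  by apply: reduces_toM; apply: reduces_toX; apply: teich_inv_reduces.
rewrite /G (@gauss_jacobi _ _ he _ _ g) ?(prim_root_neq0 pg) //; first last.
- rewrite -exprD -(expr1 g) teich_inv_gen expr1 -(prim_expr_order pz).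
  by rewrite (eq_prim_root_expr pz) modnn modn_small ?addn1.
- exact: teich_inv_exp_mult_char.
- exact: teich_inv_exp_mult_char.
congr (_ * _); apply: eq_bigr => x _; by rewrite -exprD addn1.
Qed.

Lemma rotation_sum0 : rotation_sum p r 0 = 0%N.
Proof. by apply: big1 => j _; rewrite muln0 mod0n. Qed.

(** Up to units at the chosen prime, the Gauss sum of index a is the power of
    the Gauss sum of index 1 whose exponent is the sum of the base-p digits of
    a: multiplying the index by p is the Frobenius action, and adding 1 to a
    last digit less than p - 1 costs a Jacobi sum that is a unit there. *)
Theorem stickelberger a : (0 < a < m)%N -> exists s X y,
  [/\ X ~> y, y != 0, G a * X = G 1 ^+ s &
      (s * m = p.-1 * rotation_sum p r a)%N].
Proof.
elim/ltn_ind: a => a IH /andP[a0 am]; have p_gt1 := prime_gt1 p_pr.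
have mE : m = (p ^ r).-1 by rewrite /m cardE.
have step := @rotation_sum_step p r p_gt1 _ _ card_exponent_gt0.
rewrite -mE in step.
have [pa | pa] := boolP (p %| a)%N.
  have [a' aE] := dvdnP pa; rewrite mulnC in aE.
  have a'0 : (0 < a')%N by move: a0; rewrite aE muln_gt0 => /andP[].
  have a'a : (a' < a)%N by rewrite aE ltn_Pmull.
  have [|s [X [y [hX y0 hG hs]]]] := IH _ a'a.
    by rewrite a'0 (ltn_trans a'a).
  exists s, X, y; split=> //; first by rewrite aE gauss_teich_frobenius.
  rewrite hs aE -[(p * a')%N]addn0 step ?mul0n ?addn0 //; last by rewrite -aE a0.
  exact: prime_gt0.
case: a => [//|b] in IH a0 am pa *.
have bE : b = (p * (b %/ p) + b %% p)%N by rewrite mulnC -divn_eq.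
have hb : ((b %% p).+1 < p)%N.
  rewrite ltn_neqAle ltn_mod (ltnW p_gt1) andbT; apply: contra pa => /eqP h.
  by rewrite bE -addnS h dvdn_add ?dvdnn // dvdn_mulr.
have rotS : (p.-1 * rotation_sum p r b.+1 = p.-1 * rotation_sum p r b + m)%N.
  have -> : m = (p.-1 * \sum_(j < r) p ^ j)%N by rewrite sum_expn_pred.
  rewrite -mulnDr; congr (_ * _)%N.
  have := step (b %/ p)%N _ hb; rewrite addnS -bE => -> //.
  have -> : rotation_sum p r b =
      (rotation_sum p r (b %/ p) + b %% p * \sum_(j < r) p ^ j)%N.
    have [-> | b0] := posnP b; first by rewrite div0n mod0n addn0.
    by have := step (b %/ p)%N _ (ltnW hb); rewrite -bE b0 (ltnW am) => ->.
  by lia.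
have [b0 | b0] := posnP b.
  exists 1%N, 1, 1; split.
  - exact: (reduces_to_nat z g^-1 1).
  - exact: oner_neq0.
  - by rewrite mulr1 expr1 b0.
  - by rewrite rotS b0 rotation_sum0 muln0 mul1n.
have [||s [X [y [hX y0 hG hs]]]] := IH b; rewrite ?ltnS ?b0 ?(ltnW am) //.
have [J [hJ hJG]] := gauss_teich_succ b0 am.
exists s.+1, (X * J), (y * - b.+1%:R); split.
- exact: reduces_toM.
- by rewrite mulf_neq0 // oppr_eq0 -(dvdn_pcharf pE).
- by rewrite exprSr -hG [RHS]mulrAC hJG; ring.
- by rewrite rotS mulSn hs addnC.
Qed.

(** This compares p itself with G 1.  The Gauss sums of index 1 and m - 1 have
    product p^r up to sign, which the square removes, and the digit sum of
    m - 1 is (p - 1) r - 1. *)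
Lemma stickelberger_card : exists X y,
  [/\ X ~> y, y != 0 & (G 1 ^+ (p.-1 * r)) ^+ 2 = (#|E|%:R * X) ^+ 2].
Proof.
have m1 := pred_card_gt1; have p_gt1 := prime_gt1 p_pr.
have [|s [X [y [hX y0 hG hs]]]] := @stickelberger m.-1; first by lia.
have sE : s.+1 = (p.-1 * r)%N.
  apply/eqP; rewrite -(eqn_pmul2r (ltnW m1)) mulSn hs.
  have {1}-> : m = (p.-1 * \sum_(j < r) p ^ j)%N.
    by rewrite sum_expn_pred /m cardE.
  rewrite -mulnDr -mulnA; apply/eqP; congr (_ * _)%N.
  rewrite -big_split /= -(card_ord r) -sum_nat_const card_ord.
  apply: eq_bigr => j _; rewrite -cardE -/m.
  have pj : (p ^ j < m)%N.
    have : (p ^ j.+1 <= p ^ r)%N by rewrite leq_exp2l.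
    have : (0 < p ^ j)%N by rewrite expn_gt0 ltnW.
    rewrite -cardE pred_card_eq expnS; nia.
  have -> : (p ^ j * m.-1 = (p ^ j).-1 * m + (m - p ^ j))%N.
    have : (0 < p ^ j)%N by rewrite expn_gt0 ltnW.
    move: pj; set P := (p ^ j)%N; nia.
  rewrite modnMDl modn_small; first by rewrite subnKC // ltnW.
  have : (0 < p ^ j)%N by rewrite expn_gt0 ltnW.
  by lia.
exists X, y; split=> //.
have tauV x : tau x ^+ m.-1 = tau x^-1 ^+ 1.
  have [-> | x0] := eqVneq x 0.
    by rewrite invr0 teich_inv0 !expr0n; case: m m1 => [|[]].
  rewrite expr1 mult_charV; last exact: teich_inv_mult_char.
  apply: (mulfI (mult_char_neq0 teich_inv_mult_char x0)).
  rewrite -exprS divff ?(mult_char_neq0 teich_inv_mult_char) //.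
  rewrite prednK ?(ltnW m1) //.
  have tm := teich_inv_mult_char.
  by rewrite -(mult_charX _ _ tm) expf_card_pred //; case: tm.
have hG' : G 1 * G m.-1 = tau (-1) ^+ 1 * #|E|%:R.
  have g0 := prim_root_neq0 pg.
  rewrite -(@gaussV _ _ he (fun x => tau x ^+ 1) g) //; first last.
  - rewrite expr1 -(expr1 g) teich_inv_gen -(prim_expr_order pz).
    by rewrite (eq_prim_root_expr pz) modnn modn_small.
  - exact: teich_inv_exp_mult_char.
  by congr (_ * _); apply: eq_bigr => x _; rewrite tauV.
rewrite -sE (exprS (G 1)) -hG mulrA hG' expr1 -mulrA exprMn.
by rewrite (mult_charN1_sq teich_inv_mult_char) mul1r.
Qed.

End Stickelberger.

(** * Residues modulo 4l *)

Definition res_class (l e : nat) (c : 'I_(4 * l)) : bool :=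
  ((c %% 4 == e) && ~~ (l %| c))%N.

Section ResidueClasses.

Local Open Scope nat_scope.

Variable l : nat.
Hypotheses (l_pr : prime l) (l4 : l %% 4 = 3).

Lemma sum_mod4_3_1 n : \sum_(c < 4 * n | c %% 4 == 3) c =
  \sum_(c < 4 * n | c %% 4 == 1) c + 2 * n.
Proof.
rewrite big_mkcond [X in _ = X + _]big_mkcond /=.
elim: n => [|n IH]; first by rewrite !muln0 !big_ord0.
rewrite mulnS !addSn add0n !big_ord_recr /= IH.
have -> : (4 * n) %% 4 = 0 by rewrite modnMr.
have -> : (4 * n).+1 %% 4 = 1 by rewrite -addn1 mulnC modnMDl.
have -> : (4 * n).+2 %% 4 = 2 by rewrite -addn2 mulnC modnMDl.
have -> : (4 * n).+3 %% 4 = 3 by rewrite -addn3 mulnC modnMDl.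
rewrite /=; lia.
Qed.

(** As l = 3 modulo 4, a class modulo 4 contains a single multiple of l below
    4l. *)
Lemma sum_mod4_dvdn e k : k < 4 -> (k * 3) %% 4 = e ->
  \sum_(c < 4 * l | (c %% 4 == e) && (l %| c)) c = k * l.
Proof.
move=> k4 ke; have l0 := prime_gt0 l_pr.
have kl : k * l < 4 * l by rewrite ltn_pmul2r.
rewrite (big_pred1 (Ordinal kl)) // => c; rewrite /= -val_eqE /=.
apply/andP/eqP => [[/eqP ce /dvdnP[q cq]] | ->]; last first.
  by rewrite dvdn_mull // -modnMmr l4 ke.
have q4 : q < 4 by have := ltn_ord c; rewrite cq ltn_pmul2r.
rewrite cq; congr (_ * _); move: ce; rewrite cq -modnMmr l4 -ke.
by clear -k4 q4; lia.
Qed.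

(** Pairing c with c + 2 gives 2l over all residues; the excluded multiples of
    l are l in the class of 3 and 3l in the class of 1, which gives 2l more. *)
Lemma sum_res_class : \sum_(c | @res_class l 3 c) c =
  \sum_(c | @res_class l 1 c) c + 4 * l.
Proof.
have h3 := sum_mod4_dvdn (k := 1) (e := 3) isT erefl.
have h1 := sum_mod4_dvdn (k := 3) (e := 1) isT erefl.
have := sum_mod4_3_1 l.
rewrite [LHS](bigID (fun c : 'I_(4 * l) => l %| c)) /= h3.
rewrite [X in _ = X + _](bigID (fun c : 'I_(4 * l) => l %| c)) /= h1.
by rewrite /res_class; lia.
Qed.

Lemma muln4_gt0 : 0 < 4 * l. Proof. by rewrite muln_gt0 (prime_gt0 l_pr). Qed.

Definition affine_mod (u v : nat) (c : 'I_(4 * l)) : 'I_(4 * l) :=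
  Ordinal (ltn_pmod (u * c + v) muln4_gt0).

Lemma affine_mod_inj u v : coprime (4 * l) u -> injective (affine_mod u v).
Proof.
move=> cu c d /(congr1 val) /= /eqP; rewrite eqn_modDr => h.
wlog cd : c d h / d <= c.
  move=> W; have [/W | /ltnW /W] := leqP d c; first exact.
  by rewrite eq_sym => /(_ h).
move: h; rewrite eqn_mod_dvd ?leq_mul2l ?cd ?orbT // -mulnBr Gauss_dvdr // => h.
apply/val_inj/eqP; rewrite eqn_leq cd andbT -subn_eq0; apply: contraTT h => h.
by rewrite gtnNdvd // ?lt0n // (leq_ltn_trans (leq_subr _ _)).
Qed.

Lemma dvdn_affine_mod d u v (c : 'I_(4 * l)) : d %| 4 * l ->
  affine_mod u v c = u * c + v %[mod d].
Proof. by move=> h; rewrite /= modn_dvdm. Qed.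

End ResidueClasses.

Section NoSymmetry.

Variables (E : finFieldType) (p r l : nat) (g : E) (z : algC) (e : E -> algC).
Hypotheses (p_pr : prime p) (p_gt2 : (2 < p)%N) (cardE : #|E| = (p ^ r)%N).
Let m := #|E|.-1.
Hypotheses (pg : m.-primitive_root g) (pz : m.-primitive_root z).
Hypotheses (he : add_char e) (eF : forall x, e (x ^+ p) = e x).
Hypotheses (p4 : (p %% 4 = 1)%N) (l_pr : prime l) (l4 : (l %% 4 = 3)%N).
Variable D : nat.
Hypothesis mD : (m = 4 * l * D)%N.

Local Notation tau := (teich_inv g z).
Local Notation G := (gauss_teich g z e).
Local Notation C := (@res_class l).
Local Notation "X ~> y" := (reduces_to z g^-1 X y) (at level 70).

Lemma gauss_teich_mod a : ~~ (m %| a)%N -> G (a %% m) = G a.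
Proof.
move=> ma; apply: eq_bigr => x _; congr (_ * _).
have ht := teich_inv_mult_char pg pz; have [-> | x0] := eqVneq x 0.
  have a0 : (a == 0)%N = false.
    by apply: contraNF ma => /eqP ->; rewrite dvdn0.
  by rewrite teich_inv0 !expr0n a0; move: ma; rewrite /dvdn => /negPf ->.
have tm : tau x ^+ m = 1.
  by rewrite -(mult_charX x m ht) expf_card_pred //; case: ht.
by rewrite [in RHS](divn_eq a m) exprD mulnC exprM tm expr1n mul1r.
Qed.

Lemma dvdn_index c : (m %| c * D)%N = (4 * l %| c)%N.
Proof.
have m1 : (0 < m)%N by rewrite (prim_order_gt0 pg).
by rewrite mD dvdn_pmul2r //; move: m1; rewrite mD muln_gt0 => /andP[].
Qed.

Lemma res_class_ndvd k c : C k c -> ~~ (m %| c * D)%N.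
Proof.
move=> /andP[_ lc]; rewrite dvdn_index; apply: contra lc.
by apply: dvdn_trans; rewrite dvdn_mull.
Qed.

(** As m = 4l D, the rotations of c D are the multiples of D by the residues of
    p^j c modulo 4l, and multiplication by p^j permutes the class. *)
Lemma sum_rotation_res_class k :
  (\sum_(c | C k c) rotation_sum p r (c * D) = r * (D * \sum_(c | C k c) c))%N.
Proof.
rewrite /rotation_sum exchange_big /= -[r in RHS]card_ord -sum_nat_const.
apply: eq_bigr => j _; rewrite -cardE -/m mD [RHS]mulnC.
under eq_bigr => c _ do rewrite mulnA -muln_modl.
rewrite -big_distrl /=; congr (_ * _)%N.
have coP : coprime (4 * l) (p ^ j).
  have r0 := card_exponent_gt0 cardE.
  have := coprime_pred_expn (prime_gt1 p_pr) j r0.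
  by rewrite -cardE -/m mD coprimeMl => /andP[].
have hinj := @affine_mod_inj l l_pr (p ^ j) 0 coP.
rewrite [RHS](reindex_inj hinj) /=.
apply: eq_big => [c|c _]; last by rewrite addn0.
rewrite /res_class -[in RHS](modn_mod (affine_mod _ _ _ c)).
rewrite dvdn_affine_mod ?dvdn_mulr //.
rewrite /= addn0 -modnMml -modnXm p4 exp1n mul1n modn_mod; congr (_ && ~~ _).
rewrite /dvdn modn_dvdm ?dvdn_mull // -/(dvdn l (p ^ j * c)) Gauss_dvdr //.
by move: coP; rewrite coprimeMl => /andP[].
Qed.

Lemma prod_gauss_res_class k : exists t X y,
  [/\ X ~> y, y != 0, (\prod_(c | C k c) G (c * D)) * X = G 1 ^+ t &
   (t * m = p.-1 * (r * (D * \sum_(c | C k c) c)))%N].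
Proof.
pose K (A : algC) (n : nat) := exists t X y,
  [/\ X ~> y, y != 0, A * X = G 1 ^+ t & (t * m = p.-1 * n)%N].
rewrite -sum_rotation_res_class; apply: (big_ind2 K).
- exists 0%N, 1, 1; split; rewrite ?oner_neq0 ?mulr1 ?muln0 //.
  exact: (reduces_to_nat z g^-1 1).
- move=> A a B b [t [X [y [hX y0 hA ht]]]] [u [Y [y' [hY y'0 hB hu]]]].
  exists (t + u)%N, (X * Y), (y * y'); split.
  + exact: reduces_toM.
  + by rewrite mulf_neq0.
  + by rewrite mulrACA hA hB exprD.
  + by rewrite mulnDl ht hu mulnDr.
- move=> c hc; have hm := res_class_ndvd hc.
  have m0 : (0 < m)%N := prim_order_gt0 pg.
  apply: (stickelberger p_pr p_gt2 cardE pg pz he eF).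
  apply/andP; split; first by rewrite lt0n; apply: contra hm => /eqP ->.
  rewrite -/m mD ltn_pmul2r //; by move: m0; rewrite mD muln_gt0 => /andP[].
Qed.

(** The product of the G (c * D) over the class of 3 is the power of G 1 with
    exponent (p - 1) r more than that for the class of 1, up to units at the
    prime, and G 1 ^+ ((p - 1) r) is p^r up to such units.  But c -> c + 2l
    maps the class of 1 onto the class of 3, so the assumed symmetry would make
    the two products equal up to a root of unity. *)
Theorem gauss_not_symmetric :
  ~ (forall c, odd c -> ~~ (l %| c)%N ->
       G (c * D) ^+ 4 = G ((c + 2 * l) * D) ^+ 4).
Proof.
move=> H; have m0 : (0 < m)%N := prim_order_gt0 pg.
have [t1 [X1 [y1 [hX1 y10 h1 ht1]]]] := prod_gauss_res_class 1.
have [t3 [X3 [y3 [hX3 y30 h3 ht3]]]] := prod_gauss_res_class 3.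
have [X [y [hX y0 hM]]] := stickelberger_card p_pr p_gt2 cardE pg pz he eF.
have tE : (t3 = t1 + p.-1 * r)%N.
  apply/eqP; rewrite -(eqn_pmul2r m0) mulnDl ht1 ht3 sum_res_class //.
  by apply/eqP; rewrite mD; ring.
have prodE : (\prod_(c | C 1 c) G (c * D)) ^+ 4 =
    (\prod_(c | C 3 c) G (c * D)) ^+ 4.
  have hinj := @affine_mod_inj l l_pr 1 (2 * l) (coprimen1 _).
  rewrite -!prodrXl [RHS](reindex_inj hinj) /=.
  apply: eq_big => c.
    rewrite /res_class -[in RHS](modn_mod (affine_mod _ _ _ c)).
    rewrite dvdn_affine_mod ?dvdn_mulr // mul1n.
    rewrite {2}/dvdn dvdn_affine_mod ?dvdn_mull // mul1n -/(dvdn _ _).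
    rewrite dvdn_addl ?dvdn_mull //; congr (_ && _).
    rewrite modn_mod -modnDm -[in RHS]modnMmr l4.
    have : (c %% 4 < 4)%N by rewrite ltn_mod.
    by move: (c %% 4)%N => [|[|[|[|]]]].
  move=> hc; rewrite H; first last.
  - by case/andP: hc.
  - case/andP: hc => /eqP hc _; by rewrite (divn_eq c 4) hc oddD oddM andbF.
  congr (_ ^+ 4); rewrite -[in LHS]gauss_teich_mod /= ?mul1n.
    by rewrite {1}mD -muln_modl.
  rewrite dvdn_index; case/andP: hc => _; apply: contra => h.
  have : (l %| c + 2 * l)%N by apply: dvdn_trans h; rewrite dvdn_mull.
  by rewrite dvdn_addl // dvdn_mull.
have g0 : G 1 != 0.
  apply: (@gauss_neq0 _ _ he _ g).
  - exact: teich_inv_exp_mult_char.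
  - exact: prim_root_neq0 pg.
  rewrite expr1 -(expr1 g) teich_inv_gen // -(prim_expr_order pz).
  have m1 : (1 < m)%N := pred_card_gt1 p_pr p_gt2 cardE.
  by rewrite (eq_prim_root_expr pz) modnn modn_small.
(* All factors but X3 and X1 cancel; the left side is a unit at the prime and
   the right side is divisible by p. *)
have key : X3 ^+ 4 = X1 ^+ 4 * (#|E|%:R * X) ^+ 4.
  set A := \prod_(c | C 1 c) _ in h1 prodE.
  set B := \prod_(c | C 3 c) _ in h3 prodE.
  have B0 : B ^+ 4 != 0.
    rewrite -prodE expf_neq0 //; have := expf_neq0 t1 g0.
    by rewrite -h1 mulf_eq0 negb_or => /andP[].
  apply: (mulfI B0); rewrite -exprMn h3 -prodE mulrA -exprMn h1 tE exprD.
  by rewrite exprMn; congr (_ * _); rewrite -[4%N]/(2 * 2)%N !(exprM _ 2 2) hM.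
have red0 : X1 ^+ 4 * (#|E|%:R * X) ^+ 4 ~> y1 ^+ 4 * (0 * y) ^+ 4.
  have red0 : #|E|%:R ~> 0.
    have pE := card_finPcharP cardE p_pr.
    have <- : #|E|%:R = 0 :> E.
      apply/eqP; rewrite cardE -(dvdn_pcharf pE) dvdn_exp //.
      exact: card_exponent_gt0 cardE.
    exact: reduces_to_nat.
  by apply: reduces_toM; apply: reduces_toX => //; apply: reduces_toM.
have pgV : m.-primitive_root g^-1.
  have m1 : (0 < m)%N := m0.
  have -> : g^-1 = g ^+ m.-1.
    have gn0 := prim_root_neq0 pg.
    apply: (mulfI gn0); rewrite divff // -exprS prednK //.
    by rewrite (prim_expr_order pg).
  by rewrite (prim_root_exp_coprime _ pg) coprime_sym coprimenP.
have := reduces_to_inj pz pgV (reduces_toX 4 hX3); rewrite key => /(_ _ red0).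
by rewrite mul0r expr0n mulr0 => /eqP; rewrite expf_eq0 (negPf y30).
Qed.

End NoSymmetry.

(** * Additive characters and the quadratic character *)

Section AdditiveCharacter.

Variables (E : finFieldType) (p r : nat).
Hypotheses (p_pr : prime p) (cardE : #|E| = (p ^ r)%N).
Let pE : p \in [pchar E] := card_finPcharP cardE p_pr.
Implicit Types x y : E.

Lemma natr_eq_modp (a b : nat) : (a%:R == b%:R :> E) = (a == b %[mod p])%N.
Proof.
wlog ab : a b / (b <= a)%N.
  move=> W; have [/W | /ltnW /W] := leqP b a; first exact.
  by rewrite eq_sym [RHS]eq_sym.
by rewrite -subr_eq0 -natrB // -(dvdn_pcharf pE) eqn_mod_dvd.
Qed.

(** The polynomial X^p - X has no root besides the p multiples of 1. *)
Lemma prime_subfield y : y ^+ p = y -> exists2 k, (k < p)%N & y = k%:R.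
Proof.
move=> yp; pose rs := [seq (k%:R : E) | k <- iota 0 p].
have [/mapP[k]| yrs] := boolP (y \in rs).
  by rewrite mem_iota => /= kp ->; exists k.
have p1 := prime_gt1 p_pr.
have sz : size ('X^p - 'X : {poly E}) = p.+1.
  by rewrite size_polyDl size_polyXn // size_polyN size_polyX ltnS.
have := @max_poly_roots _ ('X^p - 'X : {poly E}) (y :: rs).
rewrite -size_poly_eq0 sz /= size_map size_iota ltnn => h; suff : false by [].
apply: h => //; last first.
  rewrite yrs map_inj_in_uniq ?iota_uniq // => i j.
  rewrite !mem_iota /= => ip jp /eqP; rewrite natr_eq_modp !modn_small //.
  by move/eqP.
rewrite /root !hornerE yp subrr eqxx /=; apply/allP => x /mapP[k _ ->].
by rewrite /root !hornerE -(pFrobenius_autE pE) pFrobenius_aut_nat subrr.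
Qed.

Definition abs_trace x := \sum_(i < r) x ^+ (p ^ i).

Lemma pcharX_add n x y : (x + y) ^+ (p ^ n) = x ^+ (p ^ n) + y ^+ (p ^ n).
Proof.
elim: n => [|n IH]; first by rewrite expn0 !expr1.
rewrite expnSr !exprM IH -!(pFrobenius_autE pE); exact: rmorphD.
Qed.

Lemma abs_traceD x y : abs_trace (x + y) = abs_trace x + abs_trace y.
Proof. by rewrite -big_split; apply: eq_bigr => i _; rewrite pcharX_add. Qed.

Lemma abs_trace_shift x : \sum_(i < r) x ^+ (p ^ i.+1) = abs_trace x.
Proof.
rewrite /abs_trace; case: r cardE => [|k] cE; first by rewrite !big_ord0.
rewrite big_ord_recr [RHS]big_ord_recl /= addrC expn0 expr1.
by rewrite -cE expf_card.
Qed.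

Lemma abs_traceXp x : abs_trace (x ^+ p) = abs_trace x.
Proof.
rewrite -[RHS]abs_trace_shift; apply: eq_bigr => i _.
by rewrite -exprM -expnS.
Qed.

Lemma abs_trace_fixed x : abs_trace x ^+ p = abs_trace x.
Proof.
rewrite -[RHS]abs_trace_shift -(pFrobenius_autE pE) rmorph_sum /=.
by apply: eq_bigr => i _; rewrite pFrobenius_autE -exprM -expnSr.
Qed.

(** As a polynomial the trace has degree p^(r-1), less than the order of E. *)
Lemma abs_trace_neq0 : exists x, abs_trace x != 0.
Proof.
apply/existsP; apply: contraT => /existsPn h.
have p1 := prime_gt1 p_pr.
have r0 : (0 < r)%N.
  by have := finNzRing_gt1 E; rewrite cardE; case: r.
pose P : {poly E} := \sum_(i < r) 'X^(p ^ i).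
have Pm : P = 'X^(p ^ r.-1) + \sum_(i < r.-1) 'X^(p ^ i).
  rewrite /P; case: r r0 => // k _ /=.
  by rewrite big_ord_recr /= addrC.
have sz : size P = (p ^ r.-1).+1.
  rewrite Pm size_polyDl size_polyXn // ltnS.
  apply: (leq_trans (size_sum _ _ _)); apply/bigmax_leqP => i _.
  by rewrite size_polyXn ltn_exp2l.
have P0 : P != 0 by rewrite -size_poly_eq0 sz.
have all_rt : all (root P) (enum E).
  apply/allP => x _; have := h x; rewrite negbK => /eqP hx.
  rewrite /root /P horner_sum -[X in _ == X]hx; apply/eqP; apply: eq_bigr => i _.
  by rewrite hornerXn.
have := max_poly_roots P0 all_rt (enum_uniq _).
rewrite -fintype.cardE cardE sz ltnS leq_exp2l // -[X in (X <= _)%N](prednK r0).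
by rewrite ltnn.
Qed.

(** A primitive p-th root of unity raised to the absolute trace. *)
Lemma add_char_exists : exists e : E -> algC,
  add_char e /\ forall x, e (x ^+ p) = e x.
Proof.
have [w pw] := C_prim_root_exists (prime_gt0 p_pr).
pose rep y := index y [seq (k%:R : E) | k <- iota 0 p].
have repP x : (rep (abs_trace x))%:R = abs_trace x.
  have [k kp hk] := prime_subfield (abs_trace_fixed x).
  have hin : abs_trace x \in [seq (k%:R : E) | k <- iota 0 p].
    by apply/mapP; exists k => //; rewrite mem_iota.
  have hlt : (rep (abs_trace x) < p)%N.
    by move: hin; rewrite -index_mem size_map size_iota.
  by have := nth_index 0 hin; rewrite (nth_map 0%N) ?size_iota // nth_iota.
have wE a b : (a%:R == b%:R :> E) = (w ^+ a == w ^+ b).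
  by rewrite natr_eq_modp (eq_prim_root_expr pw).
exists (fun x => w ^+ rep (abs_trace x)); split; last first.
  by move=> x; rewrite abs_traceXp.
split.
- apply/eqP; rewrite -[X in _ == X](expr0 w) -wE repP /abs_trace.
  rewrite big1 // => i _; rewrite expr0n expn_eq0.
  by rewrite gtn_eqF // prime_gt0.
- move=> x y; apply/eqP; rewrite -exprD -wE natrD !repP abs_traceD //.
- have [x hx] := abs_trace_neq0; exists x.
  by rewrite -(expr0 w) -wE repP.
Qed.

End AdditiveCharacter.

Section QuadraticCharacter.

Variable F : finFieldType.
Implicit Types x y : F.

(** Defined by counting square roots, since it is used to count points. *)
Definition quad_char x : algC := #|[set y | y ^+ 2 == x]|%:R - 1.

Local Notation chi := quad_char.

Lemma quad_char0 : chi 0 = 0.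
Proof.
rewrite /chi (_ : [set y | _] = [set 0]) ?cards1 ?subrr //.
by apply/setP => y; rewrite !inE sqrf_eq0.
Qed.

Variable g : F.
Hypotheses (pg : #|F|.-1.-primitive_root g) (F_odd : odd #|F|).

(** Translation by 1 permutes F, so comparing the sums of the elements gives
    #|F| = 0 in F; in characteristic 2 an odd #|F| would be 1. *)
Lemma odd_card_two_neq0 : 2%:R != 0 :> F.
Proof.
have cF : #|F|%:R = 0 :> F.
  apply: (addrI (\sum_(x : F) x)); rewrite addr0 [RHS](reindex_inj (addIr 1)) /=.
  by rewrite big_split /= sumr_const.
apply: contraNneq (oner_neq0 F) => F2; rewrite -[X in _ == X]cF.
by rewrite -(odd_double_half #|F|) F_odd natrD -mul2n natrM F2 mul0r addr0.
Qed.

Lemma quad_char_gen j : chi (g ^+ j) = (-1) ^+ j.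
Proof.
have g0 := prim_root_neq0 pg.
have [jo | je] := boolP (odd j).
  rewrite /chi (_ : [set y | _] = set0) ?cards0 ?sub0r.
    by rewrite -signr_odd jo expr1.
  apply/setP => y; rewrite !inE; apply: contraTF jo => /eqP yj.
  have y0 : y != 0 by rewrite -sqrf_eq0 yj expf_neq0.
  have [i _ yi] := finField_expg pg y0.
  move: yj; rewrite yi -exprM => /eqP; rewrite (eq_prim_root_expr pg) => /eqP h.
  have m2 : (2 %| #|F|.-1)%N.
    by have := finNzRing_gt1 F; move: F_odd; case: #|F| => //= n; rewrite dvdn2.
  have := congr1 (modn^~ 2) h; rewrite !(modn_dvdm _ m2) muln2 !modn2 odd_double.
  by case: (odd j).
have [k ->] : exists k, j = (k + k)%N.
  by exists j./2; rewrite addnn -[LHS](odd_double_half j) (negPf je).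
rewrite addnn -signr_odd odd_double expr0.
rewrite /chi (_ : [set y | _] = [set g ^+ k; - g ^+ k]).
  rewrite cards2; have -> : g ^+ k != - g ^+ k.
    rewrite -addr_eq0 -mulr2n -mulr_natl.
    by rewrite mulf_neq0 ?odd_card_two_neq0 ?expf_neq0.
  by rewrite addrK.
by apply/setP => y; rewrite !inE -muln2 exprM eqf_sqr.
Qed.

Lemma quad_char_mult : mult_char chi.
Proof.
split; first exact: quad_char0.
  by rewrite -(expr0 g) quad_char_gen.
move=> x y; have [-> | x0] := eqVneq x 0; first by rewrite mul0r quad_char0 mul0r.
have [-> | y0] := eqVneq y 0; first by rewrite mulr0 quad_char0 mulr0.
have [i _ ->] := finField_expg pg x0; have [j _ ->] := finField_expg pg y0.
by rewrite -exprD !quad_char_gen exprD.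
Qed.

Lemma quad_char_genN1 : chi g = -1.
Proof. by rewrite -(expr1 g) quad_char_gen. Qed.

Lemma sum_quad_char : \sum_x chi x = 0.
Proof.
apply: (@sum_mult_char _ _ g) quad_char_mult _ _; first exact: prim_root_neq0 pg.
by rewrite quad_char_genN1 eqNr oner_eq0.
Qed.

End QuadraticCharacter.

(** * The quadratic extension *)

(** Adjoin a square root of a generator of F^*, which is not a square. *)
Lemma quadratic_extension_exists (F : finFieldType) : odd #|F| ->
  exists (L : finFieldType) (f : {rmorphism F -> L}), #|L| = (#|F| ^ 2)%N.
Proof.
move=> F_odd; have [g pg] := finField_generator_exists F.
pose h : {poly F} := 'X^2 - g%:P.
have sz : size h = 3%N.
  by rewrite size_XnsubC.
have hm : h \is monic.
  by rewrite /h; apply: monicXnsubC.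
have hI : monic_irreducible_poly h.
  split=> //; apply: cubic_irreducible; first by rewrite sz.
  move=> x; rewrite /root !hornerE subr_eq0; apply/eqP => xg.
  have := quad_char_genN1 pg F_odd; rewrite -xg.
  rewrite (mult_charX x 2 (quad_char_mult pg F_odd)) => h2.
  have x0 : x != 0.
    by apply: contraNneq (prim_root_neq0 pg) => x0; rewrite -xg x0 expr0n.
  have [j _ xj] := finField_expg pg x0; move: h2; rewrite xj quad_char_gen //.
  rewrite -exprM mulnC exprM sqrrN !expr1n => /eqP.
  by rewrite eq_sym eqNr oner_eq0.
exists {poly %/ h with hI}, (in_alg {poly %/ h with hI}).
by rewrite card_qfpoly sz.
Qed.

Lemma sum_unity_powers (L : finFieldType) (V : nmodType) n l (w : L)
    (f : L -> V) : n.-primitive_root w -> coprime l n ->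
  \sum_(t | t ^+ n == 1) f (t ^+ l) = \sum_(t | t ^+ n == 1) f t.
Proof.
move=> pw ln; rewrite (sum_unity_roots _ pw).
have pwl : n.-primitive_root (w ^+ l) by rewrite (prim_root_exp_coprime _ pw).
by rewrite (sum_unity_roots f pwl); apply: eq_bigr => j _; rewrite exprAC.
Qed.

Section Tori.

Variables (F L : finFieldType) (iota_L : {rmorphism F -> L}) (p r : nat).
Hypotheses (p_pr : prime p) (cardF : #|F| = (p ^ r)%N) (F_odd : odd #|F|).
Hypothesis cardL : #|L| = (#|F| ^ 2)%N.
Let Q := #|F|.
Variable gL : L.
Hypothesis pgL : #|L|.-1.-primitive_root gL.
Implicit Types (x y : F) (t z w : L).

Local Notation io := iota_L.

Let Q1 : (1 < Q)%N := finNzRing_gt1 F.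

Lemma card_extension_pred : #|L|.-1 = (Q.-1 * Q.+1)%N.
Proof.
by rewrite cardL -subn1 -[X in (_ - X)%N](exp1n 2) subn_sqr subn1 addn1.
Qed.

Lemma norm_gen_prim : Q.-1.-primitive_root (gL ^+ Q.+1).
Proof.
have := dvdn_prim_root pgL; rewrite card_extension_pred => /(_ Q.-1).
by rewrite mulKn; [apply; rewrite dvdn_mulr | move: Q1; case: Q => [|[]]].
Qed.

Lemma norm1_gen_prim : Q.+1.-primitive_root (gL ^+ Q.-1).
Proof.
have := dvdn_prim_root pgL; rewrite card_extension_pred => /(_ Q.+1).
by rewrite mulnK //; apply; rewrite dvdn_mull.
Qed.

Lemma frobQ_F x : io x ^+ Q = io x.
Proof. by rewrite -rmorphXn expf_card. Qed.

Lemma frobQ_fixed w : w ^+ Q = w -> exists x, io x = w.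
Proof.
move=> wQ; have [-> | w0] := eqVneq w 0; first by exists 0; rewrite rmorph0.
have [g pg] := finField_generator_exists F.
have pg' : Q.-1.-primitive_root (io g) by rewrite fmorph_primitive_root.
have w1 : w ^+ Q.-1 = 1.
  by apply: (mulfI w0); rewrite -exprS prednK ?(ltnW Q1) // wQ mulr1.
by have [i ->] := prim_rootP pg' w1; exists (g ^+ i); rewrite rmorphXn.
Qed.

Lemma frobQ_add z w : (z + w) ^+ Q = z ^+ Q + w ^+ Q.
Proof.
have cL : #|L| = (p ^ (r * 2))%N by rewrite cardL cardF expnM.
by rewrite /Q cardF; apply: (pcharX_add p_pr cL).
Qed.

Lemma frobQ_frobQ z : z ^+ Q ^+ Q = z.
Proof. by rewrite -exprM mulnn -cardL expf_card. Qed.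

(** A total left inverse of the embedding of F into L. *)
Definition descend w : F := odflt 0 [pick x | io x == w].

Lemma descendP w : w ^+ Q = w -> io (descend w) = w.
Proof.
move=> /frobQ_fixed [x xw]; rewrite /descend.
by case: pickP => [y /eqP // | /(_ x)]; rewrite xw eqxx.
Qed.

Lemma descendK x : descend (io x) = x.
Proof. by apply: (fmorph_inj io); apply: descendP; apply: frobQ_F. Qed.

Definition rel_trace z := descend (z + z ^+ Q).

Lemma rel_traceP z : io (rel_trace z) = z + z ^+ Q.
Proof. by apply: descendP; rewrite frobQ_add frobQ_frobQ addrC. Qed.

Lemma rel_traceD z w : rel_trace (z + w) = rel_trace z + rel_trace w.
Proof.
by apply: (fmorph_inj io); rewrite rmorphD /= !rel_traceP frobQ_add addrACA.
Qed.

Lemma rel_traceZ x z : rel_trace (io x * z) = x * rel_trace z.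
Proof.
apply: (fmorph_inj io); rewrite rmorphM /= !rel_traceP exprMn frobQ_F.
by rewrite mulrDr.
Qed.

Lemma rel_traceX_p z : rel_trace (z ^+ p) = rel_trace z ^+ p.
Proof.
have cL : #|L| = (p ^ (r * 2))%N by rewrite cardL cardF expnM.
apply: (fmorph_inj io); rewrite rmorphXn /= !rel_traceP exprAC.
by have := pcharX_add p_pr cL 1 z (z ^+ Q); rewrite !expn1.
Qed.

Lemma rel_trace_neq0 : exists z, rel_trace z != 0.
Proof.
exists (io 2%:R^-1); have F2 := odd_card_two_neq0 F_odd.
rewrite -(fmorph_eq0 io) rel_traceP frobQ_F -rmorphD fmorph_eq0.
by rewrite -[X in X + _]mulr1 -[X in _ + X]mulr1 -mulrDr mulVf ?oner_neq0.
Qed.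

(** The elements t with t + 1/t = x are the roots of T^2 - x T + 1. If an
    element b is in both F^* and the group of norm 1 elements, then b^2 = 1, so
    that b is the only root. *)
Lemma card_torus_fiber x :
  (#|[set t : L | (t ^+ Q.-1 == 1)%R & (t + t^-1 == io x)%R]| +
   #|[set t : L | (t ^+ Q.+1 == 1)%R & (t + t^-1 == io x)%R]| <= 2)%N.
Proof.
set A := [set t | _ & _]; set B := [set t | _ & _].
have neq0 n t : (0 < n)%N -> t ^+ n == 1 -> t != 0.
  move=> n0; apply: contraTneq => ->.
  by rewrite expr0n gtn_eqF // eq_sym oner_eq0.
have qp : (0 < Q.-1)%N by move: Q1; case: Q => [|[]].
have A0 t : t \in A -> t != 0 /\ t + t^-1 = io x.
  by rewrite inE => /andP[/(neq0 _ _ qp) t0 /eqP].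
have B0 t : t \in B -> t != 0 /\ t + t^-1 = io x.
  by rewrite inE => /andP[/(neq0 _ _ (ltn0Sn _)) t0 /eqP].
have AB t : t \in A :|: B -> t != 0 /\ t + t^-1 = io x.
  by rewrite in_setU => /orP[/A0 | /B0].
have two t u : t \in A :|: B -> u \in A :|: B -> u \in [set t; t^-1].
  move=> /AB [t0 tx] /AB [u0 ux]; rewrite !inE.
  have : (u - t) * (u - t^-1) = 0.
    have -> : (u - t) * (u - t^-1) = u * (u + u^-1 - (t + t^-1)).
      by field; rewrite t0 u0.
    by rewrite tx ux subrr mulr0.
  by move/eqP; rewrite mulf_eq0 !subr_eq0.
rewrite -cardsUI; have [->|[b]] := set_0Vmem (A :&: B).
  rewrite cards0 addn0; have [->|[t tAB]] := set_0Vmem (A :|: B).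
    by rewrite cards0.
  apply: leq_trans (subset_leq_card (_ : _ \subset [set t; t^-1])) _.
    by apply/subsetP => u /(two _ _ tAB).
  by rewrite cards2; case: (_ != _).
rewrite in_setI => /andP[bA bB].
have bb : b^-1 = b.
  have [b0 _] := A0 _ bA; apply: (mulfI b0); rewrite divff //.
  move: bA bB; rewrite !inE => /andP[/eqP h1 _] /andP[/eqP h2 _].
  by rewrite -h2 -(prednK (ltnW Q1)) -(prednK (ltnW Q1)) 2!exprSr h1 mul1r.
have sub : A :|: B \subset [set b].
  apply/subsetP => u hu; have bAB : b \in A :|: B by rewrite in_setU bA.
  by have := two b u bAB hu; rewrite bb !inE orbb.
have le1 (S : {set L}) : S \subset [set b] -> (#|S| <= 1)%N.
  by move=> /subset_leq_card; rewrite cards1.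
rewrite -[2%N]/(1 + 1)%N leq_add ?le1 //.
by apply: subset_trans sub; rewrite subIset // subsetUl.
Qed.

Lemma descend_torus n t : (n = Q.-1 \/ n = Q.+1)%N -> t ^+ n == 1 ->
  io (descend (t + t^-1)) = t + t^-1.
Proof.
move=> hn /eqP tn; apply: descendP; rewrite frobQ_add exprVn.
have t0 : t != 0.
  apply: contra_eq_neq tn => ->; rewrite expr0n eq_sym.
  by case: hn => ->; rewrite gtn_eqF ?oner_neq0 //; move: Q1; case: Q => [|[]].
case: hn => hn.
  have -> : t ^+ Q = t by rewrite -(prednK (ltnW Q1)) exprS -hn tn mulr1.
  by [].
have -> : t ^+ Q = t^-1 by apply: (mulfI t0); rewrite -exprS -hn tn divff.
by rewrite invrK addrC.
Qed.

(** The fibres have at most two elements and the two groups have 2 Q elements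
    in all, so every fibre has exactly two. *)
Lemma torus_sum (V : zmodType) (f : F -> V) :
  \sum_(t : L | t ^+ Q.-1 == 1) f (descend (t + t^-1)) +
  \sum_(t : L | t ^+ Q.+1 == 1) f (descend (t + t^-1)) = (\sum_x f x) *+ 2.
Proof.
pose N n x := #|[set t : L | (t ^+ n == 1)%R & (t + t^-1 == io x)%R]|.
have sumE (W : zmodType) (h : F -> W) n : (n = Q.-1 \/ n = Q.+1)%N ->
    \sum_(t : L | t ^+ n == 1) h (descend (t + t^-1)) = \sum_x h x *+ N n x.
  move=> hn; rewrite (partition_big (fun t => descend (t + t^-1)) xpredT) //=.
  apply: eq_bigr => x _.
  rewrite (eq_bigr (fun=> h x)) => [|t /andP[_ /eqP -> //]].
  rewrite sumr_const; congr (_ *+ _); apply: eq_card => t; rewrite !inE.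
  rewrite unfold_in /=; case: (boolP (t ^+ n == 1)) => //= tn.
  by rewrite -(inj_eq (fmorph_inj io)) (descend_torus hn).
have cardN k (w : L) : (k = Q.-1 \/ k = Q.+1)%N -> k.-primitive_root w ->
    (\sum_x N k x)%N = k.
  move=> hn pw; apply/eqP; rewrite -(eqr_nat rat) natr_sum; apply/eqP.
  rewrite -[RHS](_ : \sum_(t : L | t ^+ k == 1) 1 = _).
    by rewrite (sumE rat (fun=> 1)).
  by rewrite (sum_unity_roots (fun=> 1) pw) sumr_const card_ord.
have N2 x : (N Q.-1 x + N Q.+1 x = 2)%N.
  have hle y : (N Q.-1 y + N Q.+1 y <= 2 ?= iff (N Q.-1 y + N Q.+1 y == 2))%N.
    apply/leqifP; case: eqVneq => // hne.
    by rewrite ltn_neqAle hne card_torus_fiber.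
  have := leqif_sum (fun y (_ : xpredT y) => hle y).
  move=> [_]; rewrite big_split /= (cardN _ _ _ norm_gen_prim); last by left.
  rewrite (cardN _ _ _ norm1_gen_prim); last by right.
  rewrite sum_nat_const -/Q.
  have -> : (Q.-1 + Q.+1 = Q * 2)%N by move: Q1; clear; lia.
  by rewrite eqxx => /esym/forallP/(_ x)/eqP.
rewrite !sumE; [|by right|by left].
by rewrite -big_split -sumrMnl /=; apply: eq_bigr => x _; rewrite -mulrnDr N2.
Qed.

End Tori.

(** * Sums along arithmetic progressions *)

Section Decimation.

Variable H : nat -> algC.

Lemma sum_periodic_mul d M a : (forall i, H (i + d * M) = H i) ->
  \sum_(j < a * M) H (d * j) = (\sum_(j < M) H (d * j)) *+ a.
Proof.
move=> Hp; elim: a => [|a IH]; first by rewrite mul0n big_ord0 mulr0n.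
rewrite mulSn big_split_ord /= mulrS; congr (_ + _); rewrite -IH.
by apply: eq_bigr => j _; rewrite mulnDr addnC Hp.
Qed.

Lemma sum_multiples d M : (0 < d)%N ->
  \sum_(i < d * M) (if (d %| i)%N then H i else 0) = \sum_(j < M) H (d * j).
Proof.
move=> d0; elim: M => [|M IH]; first by rewrite muln0 !big_ord0.
rewrite mulnS addnC big_split_ord /= IH big_ord_recr /=; congr (_ + _).
rewrite (bigD1 (Ordinal d0)) //= addn0 dvdn_mulr // big1 ?addr0 // => i hi.
rewrite dvdn_addr ?dvdn_mulr // gtnNdvd // lt0n.
by apply: contra hi => /eqP h; apply/eqP/val_inj.
Qed.

Lemma sum_root_powers d (eta : algC) i : d.-primitive_root eta ->
  \sum_(k < d) eta ^+ (k * i) = if (d %| i)%N then d%:R else 0.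
Proof.
move=> pe; have [di | di] := ifP.
  under eq_bigr => k _.
    rewrite (_ : _ ^+ _ = 1); last first.
      by apply/eqP; rewrite -(prim_order_dvd pe) dvdn_mull.
    over.
  by rewrite sumr_const card_ord.
under eq_bigr do rewrite mulnC exprM.
apply: sum_geom_unity; first by rewrite exprAC (prim_expr_order pe) expr1n.
by rewrite -(prim_order_dvd pe) di.
Qed.

(** Summing the powers eta^(k i) over k selects the i divisible by d. *)
Lemma decimation d N (eta : algC) : d.-primitive_root eta -> (d %| N)%N ->
  (forall i, H (i + N) = H i) ->
  \sum_(j < N) H (d * j) = \sum_(k < d) \sum_(i < N) eta ^+ (k * i) * H i.
Proof.
move=> pe /dvdnP[M ->]; rewrite mulnC => Hp; have d0 := prim_order_gt0 pe.
rewrite sum_periodic_mul // -sum_multiples // exchange_big /= -sumrMnl.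
apply: eq_bigr => i _; rewrite -mulr_suml sum_root_powers //.
by case: ifP; rewrite ?mul0r ?mul0rn // mulr_natl.
Qed.

End Decimation.

Lemma prim_root_half d (w : algC) : (2 * d).-primitive_root w -> w ^+ d = -1.
Proof.
move=> pw; have d0 : (0 < d)%N by have := prim_order_gt0 pw; rewrite muln_gt0.
have /eqP := prim_expr_order pw; rewrite mulnC exprM sqrf_eq1 => /orP[|/eqP //].
by rewrite -(prim_order_dvd pw) gtnNdvd // -[X in (X < _)%N]mul1n ltn_pmul2r.
Qed.

(** The sign (-1)^j is w^(2 l j), so h twisted by w^l turns the first sum into
    a sum of values at the multiples of 2l, and the second one into a sum of
    values at the multiples of 2.  By decimation they involve the frequencies
    2k + l with k < 2l, resp. those with k = 0 and k = l: the difference drops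
    the last two. *)
Lemma twisted_decimation (h : nat -> algC) l N (w : algC) :
  (4 * l).-primitive_root w -> (2 * l %| N)%N ->
  (forall i, w ^+ (l * (i + N)) * h (i + N)%N = w ^+ (l * i) * h i) ->
  \sum_(j < N) (-1) ^+ (l * j) * h (2 * (l * j))%N
    - \sum_(j < N) (-1) ^+ j * h (2 * j)%N =
  \sum_(k < 2 * l | (k != 0 :> nat) && (k != l :> nat))
     \sum_(i < N) w ^+ ((2 * k + l) * i) * h i.
Proof.
move=> pw lN Hp; pose H i := w ^+ (l * i) * h i.
have l0 : (0 < l)%N.
  by have := prim_order_gt0 pw; rewrite muln_gt0.
have e4 : (4 * l = 2 * (2 * l))%N by rewrite mulnA.
rewrite e4 in pw; have l20 : (0 < 2 * l)%N by rewrite muln_gt0.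
have pw2 : (2 * l).-primitive_root (w ^+ 2).
  have := dvdn_prim_root pw (m := 2 * l); rewrite mulnK //; apply.
  exact: dvdn_mull.
have pN1 : 2.-primitive_root (w ^+ (2 * l)).
  have := dvdn_prim_root pw (m := 2); rewrite mulKn //; apply.
  exact: dvdn_mulr.
have wl : w ^+ (2 * l) = -1 := prim_root_half pw.
have HE i : H (2 * i)%N = (-1) ^+ i * h (2 * i)%N.
  by rewrite /H mulnCA mulnA exprM wl.
have El : \sum_(j < N) (-1) ^+ (l * j) * h (2 * (l * j))%N =
    \sum_(k < 2 * l) \sum_(i < N) w ^+ (2 * (k * i)) * H i.
  rewrite -(eq_bigr _ (fun (j : 'I_N) _ => HE (l * j)%N)).
  under eq_bigr => j _ do rewrite mulnA.
  rewrite (decimation pw2 lN Hp); apply: eq_bigr => k _.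
  by apply: eq_bigr => i _; rewrite -exprM.
have E1 : \sum_(j < N) (-1) ^+ j * h (2 * j)%N =
    \sum_(i < N) w ^+ (2 * (0 * i)) * H i + \sum_(i < N) w ^+ (2 * (l * i)) * H i.
  rewrite -(eq_bigr _ (fun (j : 'I_N) _ => HE j)) (decimation pN1 _ Hp).
    rewrite !big_ord_recl big_ord0 addr0; congr (_ + _).
    by apply: eq_bigr => i _; rewrite mul1n -exprM mulnA.
  by apply: dvdn_trans lN; rewrite dvdn_mulr.
have o0 : (0 < 2 * l)%N by [].
have ol : (l < 2 * l)%N by rewrite -[X in (X < _)%N]mul1n ltn_pmul2r.
rewrite El E1 (bigD1 (Ordinal o0)) //= (bigD1 (Ordinal ol)) /=; last first.
  by rewrite -val_eqE /= -lt0n.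
rewrite addrA [X in X - _]addrC addrK; apply: eq_big => [k | k _].
  by rewrite -!val_eqE /=.
apply: eq_bigr => i _; rewrite /H mulrA -exprD; congr (w ^+ _ * _).
by rewrite mulnDl mulnA.
Qed.

(** * Counting points through character sums *)

Lemma chebyshev_horner (K : fieldType) (x : K) d : x != 0 ->
  (phi K d).[x + x^-1] = x ^+ d + x ^- d.
Proof.
move=> x0; have [P hP] := chebyshev_identity d.
rewrite /phi; have <- : P = chebyshev d by apply/chebyshevP/eqP/hP/ratX_neq0.
exact: hP.
Qed.

Lemma chebyshev0 : chebyshev 0 = 2%:R.
Proof.
apply/esym/chebyshevP/eqP; rewrite rmorph_nat hornerMn hornerC !expr0 invr1.
by rewrite mulr2n.
Qed.

Lemma chebyshev1 : chebyshev 1 = 'X.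
Proof.
by apply/esym/chebyshevP/eqP; rewrite map_polyX hornerX !expr1.
Qed.

Lemma chebyshevSS d : chebyshev d.+2 = 'X * chebyshev d.+1 - chebyshev d.
Proof.
suff H (K : fieldType) (x : K) : x != 0 ->
    (map_poly intr ('X * chebyshev d.+1 - chebyshev d)).[x + x^-1] =
    x ^+ d.+2 + x ^- d.+2.
  by apply/esym/chebyshevP/eqP/H/ratX_neq0.
move=> x0; have := chebyshev_horner d x0; have := chebyshev_horner d.+1 x0.
rewrite /phi; move: (chebyshev d) (chebyshev d.+1) => P R hR hP.
rewrite rmorphB rmorphM /= map_polyX hornerD hornerN hornerM hornerX hP hR.
by rewrite !exprS; field; rewrite x0 expf_neq0.
Qed.

Lemma size_chebyshev d : (size (chebyshev d) <= d.+1)%N.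
Proof.
suff [] : (size (chebyshev d) <= d.+1)%N
       /\ (size (chebyshev d.+1) <= d.+2)%N by [].
elim: d => [|d [IH1 IH2]].
  rewrite chebyshev0 chebyshev1 size_polyX; split=> //.
  by rewrite -polyC_natr size_polyC_leq1.
split=> //; rewrite chebyshevSS.
apply: leq_trans (size_polyD _ _) _; rewrite geq_max size_polyN.
apply/andP; split; last by apply: leq_trans IH1 _; lia.
apply: leq_trans (size_polyMleq _ _) _; rewrite size_polyX; lia.
Qed.

Lemma size_phi (K : fieldType) d : (size (phi K d) <= d.+1)%N.
Proof. by apply: leq_trans (size_poly _ _) (size_chebyshev d). Qed.

Lemma phi_rmorph (K K' : fieldType) (f : {rmorphism K -> K'}) d x :
  f (phi K d).[x] = (phi K' d).[f x].
Proof.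
rewrite -horner_map -map_poly_comp; congr _.[_].
by apply: eq_map_poly => i /=; rewrite rmorph_int.
Qed.

(** For d odd the equation at infinity is w^2 = 0, as 2 g + 2 exceeds the
    degree. *)
Lemma card_Hpoints (F : finFieldType) d : odd d ->
  #|Hpoints F d|%:R = #|F|%:R + 1 + \sum_x quad_char (phi F d).[x].
Proof.
move=> d_odd; rewrite -sum1_card big_mkcond big_sumType /=.
rewrite [X in (_ + X)%N](_ : _ = 1%N); last first.
  rewrite (bigD1 0) //= big1 => [|w w0]; rewrite inE /= horner_coef0 coef_poly /=.
    rewrite expr0n eq_sym nth_default ?eqxx // subn0.
    by apply: leq_trans (size_phi _ _) _; rewrite /genus; lia.
  rewrite nth_default ?sqrf_eq0 ?(negPf w0) // subn0.
  by apply: leq_trans (size_phi _ _) _; rewrite /genus; lia.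
rewrite natrD addrAC; congr (_ + _).
have -> : #|F|%:R = \sum_(x : F) 1 :> algC by rewrite sumr_const.
rewrite -big_split /=.
transitivity ((\sum_x \sum_y
    (if inl (x, y) \in Hpoints F d then 1 else 0))%N%:R : algC).
  by rewrite pair_big; congr (_%:R); apply: eq_bigr => -[x y] _.
rewrite natr_sum; apply: eq_bigr => x _; rewrite /quad_char addrC subrK.
rewrite -sum1_card [in RHS]big_mkcond /=; congr (_%:R).
by apply: eq_bigr => y _; rewrite !inE.
Qed.

(** * Extremal character sums *)

(** Equality in the triangle inequality, over the 2 (l - 1) frequencies 2k + l;
    the sums depend on c modulo 4l only, and these frequencies represent all
    the odd residues modulo 4l that are not multiples of l. *)
Lemma extremal_frequencies (h : nat -> algC) l N (w q : algC) :
  odd l -> w ^+ (4 * l) = 1 ->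
  (forall c, odd c -> ~~ (l %| c)%N -> `|\sum_(i < N) w ^+ (c * i) * h i| <= q) ->
  \sum_(k < 2 * l | (k != 0 :> nat) && (k != l :> nat))
     \sum_(i < N) w ^+ ((2 * k + l) * i) * h i = (2 * l.-1)%:R * q ->
  forall c, odd c -> ~~ (l %| c)%N -> \sum_(i < N) w ^+ (c * i) * h i = q.
Proof.
move=> l_odd w1 hq hsum c c_odd lc; have l0 : (0 < l)%N := odd_gt0 l_odd.
pose P (k : 'I_(2 * l)) := (k != 0 :> nat) && (k != l :> nat).
pose J (k : 'I_(2 * l)) := \sum_(i < N) w ^+ ((2 * k + l) * i) * h i.
have hk k : P k -> `|J k| <= q.
  move=> /andP[k0 kl]; apply: hq; first by rewrite oddD oddM l_odd.
  rewrite dvdn_addl // Gauss_dvdr ?coprimen2 //; apply/negP => /dvdnP[a ka].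
  move: (ltn_ord k) k0 kl; rewrite ka ltn_pmul2r //.
  by case: a {ka} => [|[|a]] //=; rewrite mul1n eqxx.
have cardP : #|P| = (2 * l.-1)%N.
  have o0 : (0 < 2 * l)%N by rewrite muln_gt0.
  have ol : (l < 2 * l)%N by rewrite -[X in (X < _)%N]mul1n ltn_pmul2r.
  have := cardC P; rewrite card_ord => hC.
  have : #|[predC P]| = 2%N.
    have -> : #|[predC P]| = #|[set Ordinal o0; Ordinal ol]|.
      apply: eq_card => k; rewrite !inE /= !unfold_in /= negb_and !negbK.
      by rewrite -!val_eqE.
    by rewrite cards2 -val_eqE /= neq_ltn l0.
  move=> h2; rewrite h2 in hC; apply/eqP; rewrite -(eqn_add2r 2) hC; apply/eqP.
  by clear -l0; lia.
have hJ := @normC_sum_upper _ _ P J (fun=> q) hk.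
have {}hJ : forall k, P k -> J k = q.
  by apply: hJ; rewrite hsum sumr_const cardP mulr_natl.
(* 2 a + l = c + 4 l, so that a modulo 2l is the index k of the frequency c. *)
pose a := ((c + 3 * l)./2)%N.
have aE : (2 * a = c + 3 * l)%N.
  by rewrite mul2n -[RHS]odd_double_half oddD oddM c_odd l_odd.
have kl : (a %% (2 * l) < 2 * l)%N by rewrite ltn_mod muln_gt0.
have kE : (4 * l * (a %/ (2 * l)) + (2 * (a %% (2 * l)) + l) = c + 4 * l)%N.
  have := divn_eq a (2 * l); move: (a %/ _)%N (a %% _)%N => u v; nia.
rewrite -(hJ (Ordinal kl)).
  apply: eq_bigr => i _; congr (_ * _).
  transitivity (w ^+ ((c + 4 * l) * i)).
    by rewrite mulnDl exprD exprM [w ^+ (4 * l * i)]exprM w1 expr1n mulr1 -exprM.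
  by rewrite -kE mulnDl exprD -mulnA exprM w1 expr1n mul1r.
apply/andP; split; apply: contra lc => /= /eqP hv.
  suff : (l %| c + 4 * l)%N by rewrite dvdn_addl // dvdn_mull.
  by apply/dvdnP; exists (4 * (a %/ (2 * l)) + 1)%N; rewrite -kE hv; ring.
suff : (l %| c + 4 * l)%N by rewrite dvdn_addl // dvdn_mull.
by apply/dvdnP; exists (4 * (a %/ (2 * l)) + 3)%N; rewrite -kE hv; ring.
Qed.

Section QuadraticGaussSum.

Variables (F : finFieldType) (g : F) (e : F -> algC).
Hypotheses (F_odd : odd #|F|) (pg : #|F|.-1.-primitive_root g).
Hypothesis he : add_char e.

Lemma quad_charV (x : F) : quad_char x^-1 = quad_char x.
Proof.
have hm := quad_char_mult pg F_odd; rewrite (mult_charV _ hm).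
have [-> | x0] := eqVneq x 0; first by rewrite quad_char0 invr0.
have [j _ ->] := finField_expg pg x0.
by rewrite quad_char_gen // -exprVn invrN1.
Qed.

Lemma quad_gauss_exp4 : gauss (@quad_char F) e ^+ 4 = #|F|%:R ^+ 2.
Proof.
have hm := quad_char_mult pg F_odd.
have g1 : quad_char g != 1 by rewrite quad_char_genN1 // eqNr oner_eq0.
have := gaussV he hm (prim_root_neq0 pg) g1.
rewrite [X in _ * X](_ : _ = gauss (@quad_char F) e); last first.
  by apply: eq_bigr => x _; rewrite quad_charV.
rewrite -expr2 => h; rewrite (exprM _ 2 2) h exprMn mult_charN1_sq //.
by rewrite mul1r.
Qed.

Lemma quad_gauss_norm : `|gauss (@quad_char F) e| ^+ 2 = #|F|%:R.
Proof.
apply: (gauss_norm he (quad_char_mult pg F_odd) (prim_root_neq0 pg)).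
by rewrite quad_char_genN1 // eqNr oner_eq0.
Qed.

End QuadraticGaussSum.

Section SplitTorus.

Variables (F : finFieldType) (p n l : nat) (g : F).
Let q := (p ^ n)%N.
Let Q := #|F|.
Hypotheses (p_pr : prime p) (p4 : (p %% 4 = 1)%N) (cardF : #|F| = (q ^ 2)%N).
Hypotheses (l_pr : prime l) (l4 : (l %% 4 = 3)%N) (lQ : (l %| Q.-1)%N).
Hypothesis pg : Q.-1.-primitive_root g.

Local Notation chi := (@quad_char F).

(** For c odd and prime to l, the sum of frequency c is up to sign the Jacobi
    sum of tau^(c D) and chi.  Since chi = tau^(2 l D), that Jacobi sum is
    G (c D) g(chi) / G ((c + 2 l) D), where g(chi) is the quadratic Gauss
    sum. *)
Lemma split_torus_not_extremal :
  \sum_(j < Q.-1) chi (g ^+ (l * j) + (g ^+ (l * j))^-1)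
    - \sum_(j < Q.-1) chi (g ^+ j + (g ^+ j)^-1) != (2 * l.-1 * q)%:R.
Proof.
have p_gt2 : (2 < p)%N by have := prime_gt1 p_pr; clear -p4; lia.
have cF : #|F| = (p ^ (n * 2))%N by rewrite cardF /q -expnM.
have q4 : (q %% 4 = 1)%N by rewrite /q -modnXm p4 exp1n.
have Q1 : (1 < Q)%N := finNzRing_gt1 F.
have Q8 : (8 %| Q.-1)%N.
  rewrite /Q cardF; have := divn_eq q 4; rewrite q4 => ->.
  apply/dvdnP; exists (q %/ 4 * (2 * (q %/ 4) + 1))%N; rewrite -mulnn; lia.
have F_odd : odd #|F|.
  move: Q8 Q1; rewrite /Q; case: #|F| => // k Q8 _ /=.
  have : (2 %| k)%N by apply: dvdn_trans Q8.
  by rewrite dvdn2.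
have l_odd : odd l by rewrite (divn_eq l 4) l4 oddD oddM andbF.
have /dvdnP [D mD] : (4 * l %| Q.-1)%N.
  rewrite Gauss_dvd ?lQ ?(dvdn_trans _ Q8) //.
  by rewrite -[4%N]/(2 ^ 2)%N coprimeXl // coprime2n.
rewrite mulnC in mD.
have [z pz] := C_prim_root_exists (prim_order_gt0 pg).
have [e [he eF]] := add_char_exists p_pr cF.
pose w := z ^+ D.
have D0 : (0 < D)%N by have := prim_order_gt0 pg; rewrite mD muln_gt0 => /andP[].
have l0 := prime_gt0 l_pr.
have pw : (4 * l).-primitive_root w.
  have := dvdn_prim_root pz (m := 4 * l); rewrite mD mulKn ?muln_gt0 //.
  by apply; rewrite dvdn_mulr.
have hm := quad_char_mult pg F_odd; have [chi0 chi1 chiM] := hm.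
have Qe : ~~ odd Q.-1.
  by rewrite -dvdn2; apply: dvdn_trans Q8.
pose h i := chi (g ^+ i + 1).
have chiE k : chi (g ^+ k + (g ^+ k)^-1) = (-1) ^+ k * h (2 * k)%N.
  have g0 := expf_neq0 k (prim_root_neq0 pg).
  have -> : g ^+ k + (g ^+ k)^-1 = (g ^+ k)^-1 * (g ^+ (2 * k) + 1).
    by rewrite mulrDr mulr1 mulnC exprM expr2 mulKf.
  rewrite chiM (mult_charV _ hm) (quad_char_gen pg F_odd) /h; congr (_ * _).
  by rewrite -exprVn invrN1.
under eq_bigr do rewrite chiE.
under [X in _ - X]eq_bigr do rewrite chiE.
have gQ : g ^+ Q.-1 = 1 := prim_expr_order pg.
rewrite (twisted_decimation pw); first last.
- move=> i; rewrite /h mulnDr !exprD gQ mulr1; congr (_ * _).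
  suff -> : w ^+ (l * Q.-1) = 1 by rewrite mulr1.
  have wQ : w ^+ Q.-1 = 1 by rewrite /w exprAC (prim_expr_order pz) expr1n.
  by rewrite mulnC exprM wQ expr1n.
- by apply/dvdnP; exists (2 * D)%N; rewrite mD; ring.
apply/eqP => hmax.
pose tau := teich_inv g z.
have chiT x : chi x = tau x ^+ (2 * l * D).
  have [-> | x0] := eqVneq x 0.
    by rewrite chi0 /tau teich_inv0 expr0n !muln_eq0 /= !gtn_eqF.
  have [j _ ->] := finField_expg pg x0.
  rewrite quad_char_gen // /tau teich_inv_gen // exprAC; congr (_ ^+ _).
  by rewrite mulnC exprM -/w (@prim_root_half (2 * l)) // mulnA.
have ndvd c : ~~ (l %| c)%N -> ~~ (4 * l %| c)%N.
  by apply: contra; apply: dvdn_trans; rewrite dvdn_mull.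
have ndvd2 c : ~~ (l %| c)%N -> ~~ (l %| c + 2 * l)%N.
  by rewrite dvdn_addl // dvdn_mull.
have tau_g c : ~~ (l %| c)%N -> tau g ^+ (c * D) != 1.
  move=> /ndvd lc; rewrite -[g]expr1 /tau teich_inv_gen // expr1 mulnC exprM -/w.
  by rewrite -(prim_order_dvd pw).
have c_gt0 c : ~~ (l %| c)%N -> (0 < c * D)%N.
  by case: c => [|c _]; rewrite ?dvdn0 // muln_gt0.
have g0 : g != 0 := prim_root_neq0 pg.
pose G c := gauss_teich g z e (c * D).
pose J c := jacobi (fun x => tau x ^+ (c * D)) chi.
have hW c : ~~ (l %| c)%N -> mult_char (fun x => tau x ^+ (c * D)).
  by move=> lc; apply: teich_inv_exp_mult_char => //; apply: c_gt0.
have GJ c : ~~ (l %| c)%N -> G c * gauss chi e = J c * G (c + 2 * l)%N.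
  move=> lc; rewrite /G /gauss_teich (gauss_jacobi he (hW c lc) hm g0).
    congr (_ * _); apply: eq_bigr => x _; congr (_ * _).
    by rewrite chiT -exprD -mulnDl.
  by rewrite chiT -exprD -mulnDl tau_g // ndvd2.
have Jnorm c : ~~ (l %| c)%N -> `|J c| = q%:R.
  move=> lc; apply/eqP; rewrite -(@eqrXn2 _ 2) // -natrX -cardF.
  have Gn c' : ~~ (l %| c')%N -> `|G c'| ^+ 2 = #|F|%:R.
    by move=> lc'; apply: (gauss_norm he (hW _ lc') g0); apply: tau_g.
  have F0 : #|F|%:R != 0 :> algC by rewrite pnatr_eq0 -lt0n ltnW.
  have := congr1 (fun x => `|x| ^+ 2) (GJ c lc).
  rewrite !normrM !exprMn !Gn ?ndvd2 // (quad_gauss_norm F_odd pg he).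
  by move/(mulIf F0) => <-.
have sumJ c : ~~ (l %| c)%N ->
    \sum_(i < Q.-1) w ^+ (c * i) * h i = tau (-1) ^+ (c * D) * J c.
  move=> lc; have [t0 _ tM] := hW c lc.
  have -> : J c = tau (-1) ^+ (c * D) * \sum_x tau x ^+ (c * D) * chi (x + 1).
    rewrite /J /jacobi (reindex_inj oppr_inj) mulr_sumr; apply: eq_bigr => x _ /=.
    by rewrite opprK addrC mulrA -tM mulN1r.
  rewrite mulrA -expr2 (mult_charN1_sq (hW c lc)) mul1r (sum_finField_exp _ pg).
  rewrite t0 mul0r add0r; apply: eq_bigr => i _; congr (_ * _).
  by rewrite /tau teich_inv_gen // /w -!exprM; congr (_ ^+ _); ring.
have N1n c : ~~ (l %| c)%N -> `|tau (-1) ^+ (c * D)| = 1.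
  by move=> lc; apply: (mult_char_norm (hW c lc)); rewrite oppr_eq0 oner_neq0.
have Jeq := @extremal_frequencies h l Q.-1 w q%:R l_odd (prim_expr_order pw).
have {}Jeq c : odd c -> ~~ (l %| c)%N -> tau (-1) ^+ (c * D) * J c = q%:R.
  move=> co lc; rewrite -sumJ //; apply: Jeq => //; last by rewrite hmax natrM.
  by move=> c' _ lc'; rewrite sumJ // normrM N1n // mul1r Jnorm ?lexx.
apply: (gauss_not_symmetric p_pr p_gt2 cF pg pz he eF p4 l_pr l4 mD).
move=> c co lc; have q0 : q%:R ^+ 4 != 0 :> algC.
  by rewrite expf_neq0 // pnatr_eq0 -lt0n /q expn_gt0 prime_gt0.
apply: (mulIf q0); have := congr1 (fun x => x ^+ 4) (GJ c lc).
rewrite !exprMn (quad_gauss_exp4 F_odd pg he) cardF natrX -exprM => ->.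
rewrite mulrC; congr (_ * _); rewrite -(Jeq c co lc) exprMn.
by rewrite [X in X * _](exprM _ 2 2) (mult_charN1_sq (hW c lc)) expr1n mul1r.
Qed.

End SplitTorus.

Lemma sum_ord_mul (V : nmodType) (f : nat -> V) a N :
  \sum_(k < a * N) f k = \sum_(j < a) \sum_(i < N) f (j * N + i)%N.
Proof.
elim: a => [|a IH]; first by rewrite mul0n !big_ord0.
by rewrite mulSn addnC big_split_ord /= IH big_ord_recr.
Qed.

Section NonsplitTorus.

Variables (F L : finFieldType) (io : {rmorphism F -> L}) (p n l : nat) (gL : L).
Let q := (p ^ n)%N.
Let Q := #|F|.
Let m := #|L|.-1.
Hypotheses (p_pr : prime p) (p4 : (p %% 4 = 1)%N) (cardF : #|F| = (q ^ 2)%N).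
Hypotheses (l_pr : prime l) (l4 : (l %% 4 = 3)%N) (lQ : (l %| Q.+1)%N).
Hypotheses (cardL : #|L| = (Q ^ 2)%N) (pgL : m.-primitive_root gL).

Local Notation chi := (@quad_char F).
Local Notation tr := (rel_trace io).
Let w0 := gL ^+ Q.-1.

(** The element w0 = gL^(Q-1) is a generator of the norm 1 group. The
    conjugates of gL^(2k) are d^k w0^k and d^k w0^-k with d = gL^(Q+1) in F, so
    chi (w0^k + w0^-k) is (-1)^k chi (tr (gL^(2k))). For c odd and prime to l,
    the sum of frequency c is then the Eisenstein sum G (c D) / g(chi): the
    character tau^(c D) of L^* restricts to chi on F^* because (Q + 1) / (2l)
    is odd, and summing over the cosets of F^* extracts the quadratic Gauss sum
    g(chi). *)
Lemma nonsplit_torus_not_extremal :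
  \sum_(j < Q.+1) chi (descend io (w0 ^+ (l * j) + (w0 ^+ (l * j))^-1))
    - \sum_(j < Q.+1) chi (descend io (w0 ^+ j + (w0 ^+ j)^-1))
    != (2 * l.-1 * q)%:R.
Proof.
have p_gt2 : (2 < p)%N by have := prime_gt1 p_pr; clear -p4; lia.
have cF : #|F| = (p ^ (n * 2))%N by rewrite cardF /q -expnM.
have cL : #|L| = (p ^ (n * 2 * 2))%N by rewrite cardL /Q cF -expnM.
have Q4 : (Q %% 4 = 1)%N by rewrite /Q cF -modnXm p4 exp1n.
have Q1 : (1 < Q)%N := finNzRing_gt1 F.
have F_odd : odd #|F| by rewrite -/Q (divn_eq Q 4) Q4 oddD oddM andbF.
have l_odd : odd l by rewrite (divn_eq l 4) l4 oddD oddM andbF.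
have l0 := prime_gt0 l_pr.
have mE : m = (Q.-1 * Q.+1)%N := card_extension_pred cardL.
have [u uE] : exists u, Q.+1 = (2 * l * u)%N.
  have /dvdnP [u uE] : (2 * l %| Q.+1)%N.
    by rewrite Gauss_dvd ?coprime2n // lQ dvdn2 /= /Q F_odd.
  by exists u; rewrite uE mulnC.
have u_odd : odd u.
  have h4 : (Q.+1 %% 4 = 2)%N by rewrite -addn1 -modnDml Q4.
  apply: contraT => u_even; move: h4.
  rewrite uE -(odd_double_half u) (negPf u_even).
  by rewrite add0n -mul2n mulnACA mulnC modnMl.
have /dvdnP [D mD] : (4 * l %| m)%N.
  rewrite mE dvdn_mul //; apply/dvdnP; exists (Q %/ 4)%N.
  by rewrite {1}(divn_eq Q 4) Q4 addn1.
rewrite mulnC in mD.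
have [z pz] := C_prim_root_exists (prim_order_gt0 pgL).
have [e [he eF]] := add_char_exists p_pr cF.
pose w := z ^+ D.
have D0 : (0 < D)%N by have := prim_order_gt0 pgL; rewrite mD muln_gt0 => /andP[].
have pw : (4 * l).-primitive_root w.
  have := dvdn_prim_root pz (m := 4 * l); rewrite -/m mD mulKn ?muln_gt0 //.
  by apply; rewrite dvdn_mulr.
have w2l : w ^+ (2 * l) = -1 by rewrite (@prim_root_half (2 * l)) // mulnA.
have wN c : odd c -> w ^+ (c * Q.+1) = -1.
  move=> co; rewrite uE mulnCA exprM w2l -signr_odd oddM co u_odd.
  by rewrite expr1.
have trP := rel_traceP io p_pr cF cardL.
have trZ := rel_traceZ io p_pr cF cardL.
have normP := norm_gen_prim cardL pgL.
have [d dE] : exists d, io d = gL ^+ Q.+1.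
  apply: (frobQ_fixed io).
  have := prim_expr_order normP; rewrite -/Q; set x := gL ^+ Q.+1 => x1.
  by rewrite -[X in x ^+ X](prednK (ltnW Q1)) exprS x1 mulr1.
have pd : Q.-1.-primitive_root d by rewrite -(fmorph_primitive_root io) dE.
have hm := quad_char_mult pd F_odd; have [chi0 chi1 chiM] := hm.
have chid k : chi (d ^+ k) = (-1) ^+ k := quad_char_gen pd F_odd k.
pose h i := chi (tr (gL ^+ i)).
have hN i k : h (k * Q.+1 + i)%N = (-1) ^+ k * h i.
  by rewrite /h exprD mulnC exprM -dE -rmorphXn trZ chiM chid.
have gL0 : gL != 0 := prim_root_neq0 pgL.
have chiE k : chi (descend io (w0 ^+ k + (w0 ^+ k)^-1)) = (-1) ^+ k * h (2 * k)%N.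
  have w0k : w0 ^+ k != 0 by rewrite !expf_neq0.
  have w0Q : (w0 ^+ k) ^+ Q = (w0 ^+ k)^-1.
    apply: (mulfI w0k); rewrite divff // -exprS exprAC.
    by rewrite (prim_expr_order (norm1_gen_prim cardL pgL)) expr1n.
  have yE : io (descend io (w0 ^+ k + (w0 ^+ k)^-1)) = w0 ^+ k + (w0 ^+ k)^-1.
    by apply: descendP; rewrite (frobQ_add p_pr cF cardL) exprVn w0Q invrK addrC.
  set y := descend io _ in yE *.
  rewrite /h; have <- : d ^+ k * y = tr (gL ^+ (2 * k)).
    apply: (fmorph_inj io); rewrite rmorphM rmorphXn /= dE yE trP mulrDr addrC.
    have e1 : gL ^+ Q.+1 ^+ k = gL ^+ (2 * k) * w0 ^+ k.
      rewrite /w0 -!exprM -exprD -mulnDl; congr (_ ^+ (_ * _)).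
      by move: Q1; clear; lia.
    congr (_ + _); first by rewrite e1 mulfK.
    rewrite e1 -mulrA -expr2 -!exprM -exprD; congr (_ ^+ _).
    by rewrite -[X in _ = (_ * X)%N](prednK (ltnW Q1)); ring.
  by rewrite chiM chid mulrA -expr2 -exprM mulnC exprM sqrrN !expr1n mul1r.
under eq_bigr do rewrite chiE.
under [X in _ - X]eq_bigr do rewrite chiE.
rewrite (twisted_decimation pw); first last.
- move=> i; have := hN i 1%N; rewrite mul1n addnC => ->.
  by rewrite mulnDr exprD wN // expr1 mulrN1 mulN1r mulrNN.
- by rewrite uE dvdn_mulr.
apply/eqP => hmax.
pose eL t := e (tr t); have [e0 eD [x1 ex1]] := he.
have trD := rel_traceD io p_pr cF cardL.
have heL : add_char eL.
  split=> [|s t|].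
  - rewrite /eL (_ : tr 0 = 0) //; apply: (addrI (tr 0)).
    by rewrite -trD !addr0.
  - by rewrite /eL trD eD.
  - have [t t0] := rel_trace_neq0 io p_pr cF F_odd cardL.
    by exists (io (x1 / tr t) * t); rewrite /eL trZ divfK.
have eLF t : eL (t ^+ p) = eL t.
  by rewrite /eL (rel_traceX_p io p_pr cF cardL).
pose gchi := gauss chi e.
have twist t : \sum_(j < Q.-1) (-1) ^+ j * e (d ^+ j * t) = chi t * gchi.
  transitivity (\sum_y chi y * e (y * t)).
    rewrite (sum_finField_exp _ pd) chi0 mul0r add0r.
    by apply: eq_bigr => j _; rewrite chid.
  have [-> | t0] := eqVneq t 0.
    under eq_bigr do rewrite mulr0 e0 mulr1.
    by rewrite (sum_quad_char pd F_odd) chi0 mul0r.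
  rewrite (reindex_inj (mulIf (invr_neq0 t0))) /gchi /gauss mulr_sumr /=.
  apply: eq_bigr => y _; rewrite mulfVK // chiM (quad_charV F_odd pd).
  by rewrite mulrA [chi y * _]mulrC.
pose tau := teich_inv gL z.
pose G c := gauss_teich gL z eL (c * D).
pose J c := \sum_(i < Q.+1) w ^+ (c * i) * h i.
have c_gt0 c : ~~ (l %| c)%N -> (0 < c * D)%N.
  by case: c => [|c _]; rewrite ?dvdn0 // muln_gt0.
have GJ c : odd c -> ~~ (l %| c)%N -> G c = J c * gchi.
  move=> co lc; rewrite /G /gauss_teich /gauss (sum_finField_exp _ pgL).
  rewrite teich_inv0 expr0n gtn_eqF ?c_gt0 // mul0r add0r -/m.
  transitivity (\sum_(k < Q.-1 * Q.+1) w ^+ (k * c) * eL (gL ^+ k)).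
    rewrite -mE; apply: eq_bigr => k _.
    by rewrite teich_inv_gen // /w -!exprM; congr (_ ^+ _ * _); ring.
  rewrite (sum_ord_mul (fun k => w ^+ (k * c) * eL (gL ^+ k))) exchange_big.
  rewrite /J mulr_suml; apply: eq_bigr => i _ /=.
  rewrite -mulrA /h -twist mulr_sumr; apply: eq_bigr => j _.
  rewrite mulnDl exprD -mulnA [(Q.+1 * c)%N]mulnC mulnC exprM wN //.
  rewrite [(i * c)%N]mulnC [_ * w ^+ _]mulrC -mulrA; congr (_ * (_ * _)).
  by rewrite /eL exprD mulnC exprM -dE -rmorphXn trZ.
have q0 : q%:R != 0 :> algC by rewrite pnatr_eq0 -lt0n /q expn_gt0 prime_gt0.
have QE : #|F|%:R = q%:R ^+ 2 :> algC by rewrite cardF natrX.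
have Jnorm c : odd c -> ~~ (l %| c)%N -> `|J c| = q%:R.
  move=> co lc; apply/eqP; rewrite -(@eqrXn2 _ 2) //; apply/eqP.
  apply: (mulIf (expf_neq0 2 q0)); rewrite -[in LHS]QE.
  rewrite -(quad_gauss_norm F_odd pd he) -exprMn -normrM -GJ //.
  have -> : `|G c| ^+ 2 = #|L|%:R.
    apply: (@gauss_norm _ _ heL _ gL) => //.
      by apply: teich_inv_exp_mult_char => //; apply: c_gt0.
    rewrite -[gL]expr1 teich_inv_gen // expr1 mulnC exprM -/w.
    rewrite -(prim_order_dvd pw); apply: contra lc.
    by apply: dvdn_trans; rewrite dvdn_mull.
  by rewrite cardL natrX /Q QE expr2.
have Jeq : forall c, odd c -> ~~ (l %| c)%N -> J c = q%:R.
  apply: (extremal_frequencies l_odd (prim_expr_order pw)).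
    by move=> c co lc; rewrite (Jnorm c co lc) lexx.
  by rewrite hmax natrM.
apply: (gauss_not_symmetric p_pr p_gt2 cL pgL pz heL eLF p4 l_pr l4 mD).
move=> c co lc; rewrite -/(G c) -/(G (c + 2 * l)%N).
have co2 : odd (c + 2 * l) by rewrite oddD co oddM.
have lc2 : ~~ (l %| c + 2 * l)%N by rewrite dvdn_addl // dvdn_mull.
by rewrite !GJ // !Jeq.
Qed.

End NonsplitTorus.

(** As l > 2, it divides at most one of Q - 1 and Q + 1; only the corresponding
    group contributes to the sum, and the sum is 0 if l divides neither. *)
Lemma chebyshev_sum_not_extremal (F : finFieldType) (p n l : nat) :
  prime p -> prime l -> (p %% 4 = 1)%N -> (l %% 4 = 3)%N ->
  #|F| = ((p ^ n) ^ 2)%N ->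
  \sum_x quad_char (phi F l).[x] != (l.-1 * p ^ n)%:R.
Proof.
move=> p_pr l_pr p4 l4 cardF; set q := (p ^ n)%N; pose Q := #|F|.
have cF : #|F| = (p ^ (n * 2))%N by rewrite cardF -expnM.
have F_odd : odd #|F|.
  by rewrite cF oddX (divn_eq p 4) p4 oddD oddM andbF orbT.
have [L [io cardL]] := quadratic_extension_exists F_odd.
have [gL pgL] := finField_generator_exists L.
have [g pg] := finField_generator_exists F.
pose chi := @quad_char F.
pose T N k := \sum_(t : L | t ^+ N == 1) chi (descend io (t ^+ k + (t ^+ k)^-1)).
have pA : Q.-1.-primitive_root (io g) by rewrite fmorph_primitive_root.
have pB : Q.+1.-primitive_root (gL ^+ Q.-1) := norm1_gen_prim cardL pgL.
have desc := descend_torus io p_pr cF cardL.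
have tsum := torus_sum io p_pr cF cardL pgL.
have phiE N t : (N = Q.-1 \/ N = Q.+1)%N -> t ^+ N == 1 ->
    (phi F l).[descend io (t + t^-1)] = descend io (t ^+ l + (t ^+ l)^-1).
  move=> hN tN; apply: (fmorph_inj io); rewrite phi_rmorph (desc N) //.
  rewrite (desc N) //; last by rewrite exprAC (eqP tN) expr1n.
  apply: chebyshev_horner; apply: contraTneq tN => ->; rewrite expr0n eq_sym.
  by rewrite gtn_eqF ?oner_eq0 //; case: hN => -> //; apply: prim_order_gt0 pg.
have Sl : T Q.-1 l + T Q.+1 l = (\sum_x chi (phi F l).[x]) *+ 2.
  rewrite -(tsum _ (fun x => chi (phi F l).[x])); congr (_ + _).
    by apply: eq_bigr => t tN; rewrite (phiE Q.-1) //; left.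
  by apply: eq_bigr => t tN; rewrite (phiE Q.+1) //; right.
have S1 : T Q.-1 1%N + T Q.+1 1%N = 0.
  rewrite -[RHS](mul0rn _ 2) -[in RHS](sum_quad_char pg F_odd) -(tsum _ chi).
  by congr (_ + _); apply: eq_bigr => t _; rewrite expr1.
have Tco N (w : L) : N.-primitive_root w -> ~~ (l %| N)%N -> T N l = T N 1%N.
  move=> pw lN.
  rewrite /T (sum_unity_powers (fun t => chi (descend io (t + t^-1))) pw).
    by apply: eq_bigr => t _; rewrite expr1.
  by rewrite prime_coprime.
have diff : T Q.-1 l - T Q.-1 1%N + (T Q.+1 l - T Q.+1 1%N) =
    (\sum_x chi (phi F l).[x]) *+ 2.
  by rewrite -Sl addrACA -opprD S1 subr0.
apply/eqP => hS; move: diff; rewrite hS -mulrnA mulnC.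
have -> : (2 * (l.-1 * q) = 2 * l.-1 * q)%N by rewrite mulnA.
have l3 : (2 < l)%N by have := prime_gt1 l_pr; clear -l4; lia.
have [lB | lB] := boolP (l %| Q.+1)%N.
  have lA : ~~ (l %| Q.-1)%N.
    apply: contraL lB => lA; have -> : (Q.+1 = Q.-1 + 2)%N.
      by rewrite addn2 prednK // ltnW // finNzRing_gt1.
    by rewrite dvdn_addr // gtnNdvd.
  rewrite (Tco _ _ pA lA) subrr add0r /T !(sum_unity_roots _ pB).
  apply/eqP.
  have := nonsplit_torus_not_extremal io p_pr p4 cardF l_pr l4 lB cardL pgL.
  apply: contraNN => /eqP <-; apply/eqP; congr (_ - _).
    by apply: eq_bigr => j _; rewrite -!exprM [(l * j)%N]mulnC.
rewrite (Tco _ _ pB lB) subrr addr0.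
have [lA | lA] := boolP (l %| Q.-1)%N.
  rewrite /T !(sum_unity_roots _ pA); apply/eqP.
  have := split_torus_not_extremal p_pr p4 cardF l_pr l4 lA pg.
  apply: contraNN => /eqP <-; apply/eqP; congr (_ - _).
    apply: eq_bigr => j _; rewrite -!rmorphXn -fmorphV -rmorphD descendK //.
    by rewrite -exprM mulnC.
  apply: eq_bigr => j _; rewrite expr1 -rmorphXn -fmorphV -rmorphD descendK //.
rewrite (Tco _ _ pA lA) subrr => /eqP; rewrite eq_sym pnatr_eq0 !muln_eq0.
have l1 : (0 < l.-1)%N by clear -l3; lia.
by rewrite !gtn_eqF // /q expn_gt0 prime_gt0.
Qed.

Local Close Scope ring_scope.

Theorem proposition3p1p1 (l p : nat) (l_prime : prime l) (p_prime : prime p)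
    (l_mod4 : l = 3 %[mod 4]) (p_mod4 : p = 1 %[mod 4]) :
  ~ exists (n : nat) (F : finFieldType),
      [/\ 0 < n, #|F| = (p ^ n) ^ 2 & maximal_over l (p ^ n) F].
Proof.
case=> n [F [_ cardF hmax]]; rewrite /maximal_over in hmax.
have l_odd : odd l by rewrite (divn_eq l 4) l_mod4 oddD oddM andbF.
have lE : (2 * genus l = l.-1)%N.
  by rewrite mul2n /genus -[RHS]odd_double_half -subn1 oddB ?l_odd // prime_gt0.
have := chebyshev_sum_not_extremal p_prime l_prime p_mod4 l_mod4 cardF.
apply/negP; rewrite negbK; apply/eqP; apply: (addrI (#|F|%:R + 1)%R).
by rewrite -card_Hpoints // hmax lE cardF !natrD.
Qed.
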